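(* Let $A\ge 0$ be a (possibly unbounded) self-adjoint operator in a Hilbert space $\mathcal H$, and let $H$ be a bounded self-adjoint operator on $\mathcal H$ with bounded inverse $H^{-1}$. Assume that there is a self-adjoint involution $J_A$ on $\mathcal H$ commuting with $A$ such that, with $P_A:=\frac12(J_A+I)$ and $P_A^\bot:=I-P_A$, $$P_AHP_A\ge \alpha P_A,\qquad P_A^\bot HP_A^\bot\le -\alpha P_A^\bot$$ for some $\alpha\in(0,1]$. Let $\mathfrak b$ be the symmetric sesquilinear form $$\mathfrak b[x,y]:=\langle A^{1/2}x,HA^{1/2}y\rangle,\qquad x,y\in\mathrm{Dom}[\mathfrak b]:=\mathrm{Dom}(A^{1/2}).$$ Then there exists a unique self-adjoint operator $B$ with $\mathrm{Dom}(B)\subseteq\mathrm{Dom}[\mathfrak b]$ and $$\mathfrak b[x,y]=\langle x,By\rangle\quad\text{for all }x\in\mathrm{Dom}[\mathfrak b],\ y\in\mathrm{Dom}(B),$$ and this operator is $B=A^{1/2}HA^{1/2}$. If additionally the domain stability condition $\mathrm{Dom}(|B|^{1/2})=\mathrm{Dom}[\mathfrak b]$ holds, then $$\mathfrak b[x,y]=\langle |B|^{1/2}x,\mathrm{sign}(B)|B|^{1/2}y\rangle\quad\text{for all }x,y\in\mathrm{Dom}[\mathfrak b].$$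
   Context: A self-adjoint involution is a bounded self-adjoint operator $J$ with $J^2=I$; it commutes with a self-adjoint operator $A$ if $J\,\mathrm{Dom}(A)\subseteq\mathrm{Dom}(A)$ and $JAx=AJx$ for all $x\in\mathrm{Dom}(A)$. The product $A^{1/2}HA^{1/2}$ is taken on its natural domain $\{x\in\mathrm{Dom}(A^{1/2}) : HA^{1/2}x\in\mathrm{Dom}(A^{1/2})\}$. $|B|^{1/2}$ and $\mathrm{sign}(B)$ are defined by functional calculus, with $\mathrm{sign}(0):=0$. Operator inequalities are understood in the quadratic form sense. *)

(* Defs.v *)
From HB Require Import structures.
From mathcomp Require Import all_boot all_order all_algebra.
From mathcomp Require Import complex.
From mathcomp Require Import all_classical all_reals all_analysis.

Set Implicit Arguments.
Unset Strict Implicit.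
Unset Printing Implicit Defensive.

Import Order.TTheory GRing.Theory Num.Theory.
Import numFieldNormedType.Exports.

Local Open Scope classical_set_scope.
Local Open Scope complex_scope.
Local Open Scope ring_scope.

(** A complex Hilbert space is a complete normed space [V] over [R[i]] whose
    norm comes from an inner product [dot : {dot V for Num.conj}] in the sense
    of [norm_of_dot].  MathComp's [dot] is linear in its first argument. *)
Definition norm_of_dot (R : realType) (V : completeNormedModType R[i])
    (dot : {dot V for Num.conj}) : Prop :=
  forall x : V, `|x| ^+ 2 = dot x x.

(** Unbounded operators are represented by their graphs, so that equality of
    operators, domains included, is equality of sets. *)
Section Operators.
Variables (R : realType) (V : completeNormedModType R[i]).
Implicit Types (G F : set (V * V)) (T U : V -> V).

Definition is_operator G : Prop :=
  [/\ G (0, 0),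
      forall (a : R[i]) x y u v, G (x, u) -> G (y, v) ->
        G (a *: x + y, a *: u + v) &
      forall x u v, G (x, u) -> G (x, v) -> u = v].

Definition dom G : set V := [set x | exists u, G (x, u)].

(** The value at [x], which is meaningful only for [x] in [dom G]. *)
Definition app G (x : V) : V := xget 0 [set u | G (x, u)].

Definition graph T : set (V * V) := [set p | p.2 = T p.1].

(** Product [G F], on its natural domain. *)
Definition op_comp G F : set (V * V) :=
  [set p | exists y, F (p.1, y) /\ G (y, p.2)].

Definition bounded_op T : Prop :=
  exists M : R[i], forall x, `|T x| <= M * `|x|.

Definition commutes_with T G : Prop :=
  forall x, dom G x -> dom G (T x) /\ T (app G x) = app G (T x).

Variable dot : {dot V for Num.conj}.

Definition adjoint G : set (V * V) :=
  [set p | forall x u, G (x, u) -> dot u p.1 = dot x p.2].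

Definition selfadjoint G : Prop :=
  [/\ is_operator G, dense (dom G) & G = adjoint G].

(** Nonnegativity in the form sense; the order of [R[i]] makes
    [0 <= z] include that [z] is real. *)
Definition nonneg_op G : Prop := forall x, dom G x -> 0 <= dot (app G x) x.

(** [S] is the square root of [G]: the unique nonnegative self-adjoint
    operator with [S S = G]. *)
Definition is_sqrt G S : Prop :=
  [/\ selfadjoint S, nonneg_op S & op_comp S S = G].

Definition bounded_selfadjoint T : Prop :=
  bounded_op T /\ forall x y, dot (T x) y = dot x (T y).

Definition selfadjoint_involution T : Prop :=
  bounded_selfadjoint T /\ forall x, T (T x) = x.

Definition form_le T U : Prop := forall x, dot (T x) x <= dot (U x) x.

(** [P = (T + I) / 2] and [I - P]. *)
Definition proj_pos T (x : V) : V := 2^-1 *: (T x + x).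
Definition proj_neg T (x : V) : V := x - proj_pos T x.

(** Meaningful only for [x] and [y] in [dom S]. *)
Definition form_of S T (x y : V) : R[i] := dot (app S x) (T (app S y)).

Definition represents S T B : Prop :=
  [/\ selfadjoint B, dom B `<=` dom S &
      forall x y, dom S x -> dom B y -> form_of S T x y = dot x (app B y)].

End Operators.

(** Projection-valued Borel measures on the real line.  Only the values at
    measurable sets are constrained. *)
Record proj_measure (R : realType) (V : completeNormedModType R[i])
    (dot : {dot V for Num.conj}) := ProjMeasure {
  pvm :> set (measurableTypeR R) -> {linear V -> V};
  pvm_sym : forall X, measurable X ->
    forall x y, dot (pvm X x) y = dot x (pvm X y);
  pvmI : forall X Y, measurable X -> measurable Y ->
    forall x, pvm (X `&` Y) x = pvm X (pvm Y x);
  pvm0 : forall x, pvm set0 x = 0;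
  pvmT : forall x, pvm setT x = x;
  pvm_sigma_additive : forall x,
    semi_sigma_additive (fun X => (complex.Re (`|pvm X x| ^+ 2))%:E)
}.

Section FunctionalCalculus.
Variables (R : realType) (V : completeNormedModType R[i]).
Variables (dot : {dot V for Num.conj}) (E : proj_measure dot).

(** The scalar measure [d<E x, x> = d|E x|^2]. *)
Definition spec_mu (x : V) (X : set (measurableTypeR R)) : \bar R :=
  (complex.Re (`|E X x| ^+ 2))%:E.

Lemma spec_mu0 x : spec_mu x set0 = 0%E.
Proof. by rewrite /spec_mu pvm0 normr0 expr0n. Qed.

Lemma spec_mu_ge0 x X : (0 <= spec_mu x X)%E.
Proof.
have : 0 <= `|E X x| ^+ 2 by rewrite exprn_ge0.
by rewrite /spec_mu lee_fin lecE => /andP[].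
Qed.

HB.instance Definition _ x := isMeasure.Build _ _ _ (spec_mu x)
  (spec_mu0 x) (spec_mu_ge0 x) (@pvm_sigma_additive _ _ _ E x).

(** Domain of [f(B) = \int f dE]. *)
Definition fcalc_dom (f : R -> R) : set V :=
  [set x | (\int[spec_mu x]_t ((f t) ^+ 2)%:E < +oo)%E].

(** [\int f d<E x, z>] by polarization: the complex measure [<E x, z>] is
    [1/4 \sum_(k < 4) i^k <E (x + i^k z), x + i^k z>].  All four integrals are
    finite when [x] and [z] belong to [fcalc_dom f]. *)
Definition spec_integral (f : R -> R) (x z : V) : R[i] :=
  4^-1 * \sum_(k < 4) ('i)%C ^+ k *
    (\int[spec_mu (x + ('i)%C ^+ k *: z)]_t f t)%:C.

(** Graph of [f(B) = \int f dE], for real Borel [f], where [E] is the spectral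
    measure of [B]: [f(B) x] is the vector [u] with
    [<u, z> = \int f d<E x, z>], and testing against the dense subspace
    [fcalc_dom f] determines [u]. *)
Definition fcalc (f : R -> R) : set (V * V) :=
  [set p | fcalc_dom f p.1 /\
    forall z, fcalc_dom f z -> dot p.2 z = spec_integral f p.1 z].

Definition is_spectral_measure_of (B : set (V * V)) : Prop :=
  B = fcalc (fun t => t).

(** [|B|^(1/2)] and [sign(B)], where [E] is the spectral measure of [B]. *)
Definition sqrt_abs_op : set (V * V) := fcalc (fun t => Num.sqrt `|t|).
Definition sign_op : set (V * V) := fcalc Num.sg.

End FunctionalCalculus.

(* Main.v *)
Require Import Defs.
From HB Require Import structures.
From mathcomp Require Import all_boot all_order all_algebra.
From mathcomp Require Import complex.
From mathcomp Require Import all_classical all_reals all_analysis.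
From mathcomp Require Import measurable_realfun.
From mathcomp Require Import ring lra.

Import Order.TTheory GRing.Theory Num.Theory.
Import numFieldNormedType.Exports.

Local Open Scope classical_set_scope.
Local Open Scope complex_scope.
Local Open Scope ring_scope.

(** Write S for the square root of A.  Coercivity carries the first part.  For
    u in the space, J u and H u satisfy Re <J u, H u> >= alpha |u|^2: splitting
    u along the two eigenspaces of J, the off-diagonal terms of H are complex
    conjugate to each other with opposite signs and cancel in the real part
    ([indefinite_coercive]).  Since J commutes with A it commutes with S
    ([commutes_sqrt]), so Re (<J x, J x> + <S J x, H S x>) dominates the square
    of the graph norm of S.  A Lax-Milgram argument on the graph of S
    ([lax_milgram_graph]) then makes S H S + J onto.  This operator is
    symmetric, and a symmetric operator that is onto is self-adjoint; as J is
    bounded, S H S is self-adjoint too.  Any operator B representing the form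
    is contained in S H S because S is self-adjoint, and equals it because
    self-adjoint operators have no proper symmetric extensions
    ([represents_unique]).

    That J commutes with S rests on the uniqueness of nonnegative square roots,
    proved for bounded operators by an estimate on the norm of the difference
    ([bounded_sqrt_unique]) and transferred to S through the bounded operators
    (S S + 1)^-1 and S (S S + 1)^-1, which determine the graph of S
    ([graph_resolvent]).

    For the second part, f(B) is the strong limit of the operators
    \sum_i c_i E(X_i) attached to step functions converging to f ([fcalcP]).
    With T = |B|^(1/2) this gives <T x, sign(B) T x> = \int t d<E x, x>, which
    is <x, B x>, hence the value of the form at x, for x in the domain of B.
    A vector x of Dom(T) is approximated by E([-n, n]) x, which lies in Dom(B)
    and converges to x in the graph norm of T.  Because Dom(T) = Dom(S), the
    closed graph theorem ([dom_inclusion_bound]) turns this into convergence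
    in the graph norm of S, in which the form is continuous.  The two quadratic
    forms thus agree on the whole domain, and polarization finishes the proof. *)

(** * The real inner product of a complex Hilbert space *)

Section RealInnerProduct.
Context {R : realType} {V : completeNormedModType R[i]}.
Variable dot : {dot V for Num.conj}.

(** Graphs of operators are complex subspaces, so a relation between inner
    products that holds on them follows from its real part, replacing x by i x.
    Working with the real part keeps every estimate inside the ordered field R. *)
Definition rip (x y : V) : R := complex.Re (dot x y).
Definition nsq (x : V) : R := rip x x.

Lemma complex_ReD (a b : R[i]) : complex.Re (a + b) = complex.Re a + complex.Re b.
Proof. by case: a b => [a1 a2] [b1 b2]. Qed.

Lemma ripDl x y z : rip (x + y) z = rip x z + rip y z.
Proof. by rewrite /rip linearDl complex_ReD. Qed.

Lemma ripDr x y z : rip x (y + z) = rip x y + rip x z.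
Proof. by rewrite /rip linearDr complex_ReD. Qed.

Lemma ripC x y : rip x y = rip y x.
Proof. by rewrite /rip hermC /= expr0 mul1r; case: (dot y x). Qed.

Lemma ripZl (a : R) x y : rip (a%:C *: x) y = a * rip x y.
Proof.
by rewrite /rip linearZl_LR /=; case: (dot x y) => b c /=; rewrite mul0r subr0.
Qed.

Lemma ripZr (a : R) x y : rip x (a%:C *: y) = a * rip x y.
Proof. by rewrite ripC ripZl ripC. Qed.

Lemma ripNl x y : rip (- x) y = - rip x y.
Proof.
have := ripZl (-1) x y; rewrite mulN1r => <-.
by congr (rip _ _); rewrite rmorphN1 scaleN1r.
Qed.

Lemma ripNr x y : rip x (- y) = - rip x y.
Proof. by rewrite ripC ripNl ripC. Qed.

Lemma ripBl x y z : rip (x - y) z = rip x z - rip y z.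
Proof. by rewrite ripDl ripNl. Qed.

Lemma ripBr x y z : rip x (y - z) = rip x y - rip x z.
Proof. by rewrite ripDr ripNr. Qed.

Lemma rip0l y : rip 0 y = 0.
Proof. by have := ripBl 0 0 y; rewrite subrr => ->; rewrite subrr. Qed.

Lemma rip0r y : rip y 0 = 0.
Proof. by rewrite ripC rip0l. Qed.

Lemma nsqD x y : nsq (x + y) = nsq x + 2 * rip x y + nsq y.
Proof. rewrite /nsq !(ripDl, ripDr) (ripC y x); lra. Qed.

Lemma nsqN x : nsq (- x) = nsq x.
Proof. by rewrite /nsq ripNl ripNr opprK. Qed.

Lemma nsqB x y : nsq (x - y) = nsq x - 2 * rip x y + nsq y.
Proof. rewrite nsqD nsqN ripNr; lra. Qed.

Lemma nsqZ (a : R) x : nsq (a%:C *: x) = a ^+ 2 * nsq x.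
Proof. by rewrite /nsq ripZl ripZr mulrA expr2. Qed.

Lemma nsq0 : nsq 0 = 0.
Proof. exact: rip0l. Qed.

Lemma rip_iMr x y : rip x ('i%C *: y) = complex.Im (dot x y).
Proof.
rewrite /rip linearZr_LR /=; case: (dot x y) => a b /=.
by rewrite mul0r sub0r mulN1r opprK.
Qed.

Lemma rip_iMl x y : rip ('i%C *: x) y = - complex.Im (dot x y).
Proof.
by rewrite /rip linearZl_LR /=; case: (dot x y) => a b /=; rewrite mul0r sub0r mul1r.
Qed.

Hypothesis hdot : norm_of_dot dot.

Lemma nsqE x : `|x| ^+ 2 = (nsq x)%:C.
Proof.
have h := hdot x; rewrite /nsq /rip -h.
have : 0 <= `|x| ^+ 2 by rewrite exprn_ge0.
by case: (`|x| ^+ 2) => a b; rewrite lecE /= => /andP[/eqP -> _].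
Qed.

Lemma nsq_ge0 x : 0 <= nsq x.
Proof.
have : 0 <= `|x| ^+ 2 by rewrite exprn_ge0.
by rewrite nsqE ler0c.
Qed.

Lemma nsq_eq0 x : nsq x = 0 -> x = 0.
Proof.
move=> h; have := nsqE x; rewrite h => /eqP.
by rewrite sqrf_eq0 normr_eq0 => /eqP.
Qed.

Lemma rip_cauchy_schwarz x y : rip x y ^+ 2 <= nsq x * nsq y.
Proof.
have [y0|y0] := eqVneq (nsq y) 0.
  by rewrite (nsq_eq0 _ y0) rip0r nsq0 expr0n mulr0.
have yp : 0 < nsq y by rewrite lt_neqAle eq_sym y0 nsq_ge0.
have := nsq_ge0 ((nsq y)%:C *: x - (rip x y)%:C *: y).
rewrite nsqB !nsqZ ripZl ripZr.
have -> : nsq y ^+ 2 * nsq x - 2 * (nsq y * (rip x y * rip x y))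
    + rip x y ^+ 2 * nsq y = nsq y * (nsq x * nsq y - rip x y ^+ 2) by ring.
by rewrite pmulr_rge0 // subr_ge0.
Qed.

Definition rnorm x : R := Num.sqrt (nsq x).

Lemma rnorm_ge0 x : 0 <= rnorm x.
Proof. exact: sqrtr_ge0. Qed.

Lemma sqr_rnorm x : rnorm x ^+ 2 = nsq x.
Proof. by rewrite sqr_sqrtr // nsq_ge0. Qed.

Lemma rnormE x : `|x| = (rnorm x)%:C.
Proof.
apply/eqP; rewrite -(@eqrXn2 _ 2) ?ler0c ?rnorm_ge0 //.
by rewrite nsqE -rmorphXn /= sqr_rnorm.
Qed.

Lemma rip_le_rnorm x y : `|rip x y| <= rnorm x * rnorm y.
Proof.
rewrite -(@ler_pXn2r _ 2) ?nnegrE ?mulr_ge0 ?rnorm_ge0 //.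
by rewrite real_normK ?num_real // exprMn !sqr_rnorm rip_cauchy_schwarz.
Qed.

Lemma rnormD x y : rnorm (x + y) <= rnorm x + rnorm y.
Proof. by have := ler_normD x y; rewrite !rnormE -rmorphD lecR. Qed.

Lemma rnormN x : rnorm (- x) = rnorm x.
Proof. by rewrite /rnorm nsqN. Qed.

Lemma rnorm_le x (c : R) : 0 <= c -> nsq x <= c ^+ 2 -> rnorm x <= c.
Proof.
by move=> c0; rewrite -sqr_rnorm ler_pXn2r ?nnegrE ?rnorm_ge0.
Qed.

Lemma cvg_rnorm (u : nat -> V) l :
  (u @ \oo --> l) <-> (rnorm (u n - l) @[n --> \oo] --> (0 : R)).
Proof.
split.
  move=> /cvgrPdistC_lt h; apply/cvgr0Pnorm_lt => e e0.
  have /h : 0 < e%:C by rewrite ltcR.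
  apply: filterS => n; rewrite rnormE ltcR.
  by rewrite ger0_norm ?rnorm_ge0.
move=> /cvgr0Pnorm_lt h; apply/cvgrPdistC_lt => e e0.
have /h : 0 < complex.Re e by move: e0; rewrite ltcE => /andP[].
apply: filterS => n; rewrite rnormE ger0_norm ?rnorm_ge0 // => lt.
by rewrite ltcE lt andbT; move: e0; rewrite ltcE => /andP[/eqP -> _].
Qed.

Lemma cvg_nsq (u : nat -> V) l :
  (u @ \oo --> l) <-> (nsq (u n - l) @[n --> \oo] --> (0 : R)).
Proof.
rewrite cvg_rnorm; split=> h.
  rewrite -(mulr0 (0 : R)).
  under eq_fun do rewrite -sqr_rnorm expr2.
  exact: cvgM.
rewrite -(sqrtr0 R).
exact: (@continuous_cvg _ _ _ _ _ _ (fun x : R => Num.sqrt x) _ (@sqrt_continuous R 0)).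
Qed.

Lemma cvg_rip (u : nat -> V) l y :
  u @ \oo --> l -> rip (u n) y @[n --> \oo] --> rip l y.
Proof.
move=> /cvg_rnorm h; apply/subr_cvg0.
apply: (@squeeze_cvgr _ _ _ _ (fun n => - (rnorm (u n - l) * rnorm y))
  (fun n => rnorm (u n - l) * rnorm y)).
- by near=> n; rewrite -ler_norml -ripBl rip_le_rnorm.
- rewrite -oppr0 -(mul0r (rnorm y)); apply: cvgN; exact: cvgMl.
- rewrite -(mul0r (rnorm y)); exact: cvgMl.
Unshelve. all: by end_near. Qed.

Lemma cvg_ripr (u : nat -> V) l y :
  u @ \oo --> l -> rip y (u n) @[n --> \oo] --> rip y l.
Proof.
rewrite (ripC y l) (_ : (fun n => rip y (u n)) = (fun n => rip (u n) y)).
  exact: cvg_rip.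
by apply/funext => n; rewrite ripC.
Qed.

Lemma cvg_rip2 (u v : nat -> V) l m :
  u @ \oo --> l -> v @ \oo --> m ->
  rip (u n) (v n) @[n --> \oo] --> rip l m.
Proof.
move=> ul vm.
have -> : (fun n => rip (u n) (v n)) =
    (fun n => 2^-1 * (nsq (u n + v n - (l + m)) - nsq (u n - l) - nsq (v n - m))
      + rip (u n) m + rip (v n) l - rip l m).
  apply/funext => n.
  have -> : u n + v n - (l + m) = (u n - l) + (v n - m) by rewrite opprD addrACA.
  rewrite (nsqD (u n - l)) !(ripBl, ripBr).
  rewrite (ripC (v n) l); lra.
have e : rip l m = 2^-1 * (0 - 0 - 0) + rip l m + rip m l - rip l m.
  by rewrite (ripC m l); lra.
rewrite [X in _ --> X]e.
apply: cvgB; last exact: cvg_cst.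
apply: cvgD; last exact: cvg_rip.
apply: cvgD; last exact: cvg_rip.
apply: cvgMr; apply: cvgB; last by apply/cvg_nsq.
apply: cvgB; last by apply/cvg_nsq.
exact: (proj1 (cvg_nsq _ _) (cvgD ul vm)).
Qed.

Lemma cvg_of_cauchy (u : nat -> V) :
  (forall e : R, 0 < e -> exists N, forall n m, (N <= n)%N -> (N <= m)%N ->
     nsq (u n - u m) <= e) -> exists l : V, u @ \oo --> l.
Proof.
move=> h; suff /cvg_ex : cvgn u by [].
apply: cauchy_cvg; apply/cauchy_ballP => e e0.
have Re0 : 0 < complex.Re e by move: e0; rewrite ltcE => /andP[].
have [|N hN] := h ((complex.Re e / 2) ^+ 2).
  by rewrite exprn_gt0 // divr_gt0.
exists (u @` [set n | (N <= n)%N], u @` [set n | (N <= n)%N]).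
  by split; exists N => // n /= Nn; exists n.
move=> [_ _] [[n Nn <-] [m Nm <-]] /=.
rewrite -ball_normE /= rnormE.
rewrite ltcE; apply/andP; split.
  by move: e0; rewrite ltcE => /andP[].
have e20 : 0 <= complex.Re e / 2 by lra.
have /le_lt_trans := rnorm_le _ _ e20 (hN n m Nn Nm); apply; lra.
Qed.

Lemma bounded_op_rnorm (T : V -> V) : bounded_op T ->
  exists2 c : R, 0 <= c & forall x, rnorm (T x) <= c * rnorm x.
Proof.
move=> [M hM]; exists (Num.max 0 (complex.Re M)) => [|x]; first by rewrite le_max lexx.
have := hM x; rewrite !rnormE lecE => /andP[_].
have -> : complex.Re (M * (rnorm x)%:C) = complex.Re M * rnorm x.
  by case: (M) => a b /=; rewrite mulr0 subr0.
by move=> /= /le_trans; apply; rewrite ler_wpM2r ?rnorm_ge0 // le_max lexx orbT.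
Qed.

Lemma cvg_bounded_op (T : {linear V -> V}) (u : nat -> V) l :
  bounded_op T -> u @ \oo --> l -> T (u n) @[n --> \oo] --> T l.
Proof.
move=> /bounded_op_rnorm[c c0 hT] /cvg_rnorm h; apply/cvg_rnorm.
apply: (@squeeze_cvgr _ _ _ _ (fun=> 0) (fun n => c * rnorm (u n - l))).
- by near=> n; rewrite rnorm_ge0 -linearB hT.
- exact: cvg_cst.
- rewrite -(mulr0 c); exact: cvgMr.
Unshelve. all: by end_near. Qed.

Lemma rip_eq0 x : (forall y, rip x y = 0) -> x = 0.
Proof. by move=> h; apply: nsq_eq0; exact: h. Qed.

(** The imaginary part of an inner product is the real part of another one, with
    one argument multiplied by i. *)
Lemma dot_rip (u v x y : V) : (forall k : bool, 
  rip u ((if k then 'i%C else 1) *: x) = rip v ((if k then 'i%C else 1) *: y)) ->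
  dot u x = dot v y.
Proof.
move=> h; have := h true; have := h false; rewrite /= !scale1r !rip_iMr /rip.
by case: (dot u x) (dot v y) => a b [c d] /= -> ->.
Qed.

End RealInnerProduct.

(** * Density of subspaces of the graph space *)

Section GraphSpace.
Context {R : realType} {V : completeNormedModType R[i]}.
Variable dot : {dot V for Num.conj}.
Hypothesis hdot : norm_of_dot dot.
Local Notation ip := (rip dot).
Local Notation sq := (nsq dot).

(** Take t to be the minimizer c / E; if E = 0 the affine function of t can only
    be bounded below when c = 0. *)
Lemma discriminant_le (N c E d : R) :
  0 <= E -> (forall t, d <= N - 2 * t * c + t ^+ 2 * E) -> c ^+ 2 <= (N - d) * E.
Proof.
move=> E0 h; have [E00|En0] := eqVneq E 0.
  have [->|c0] := eqVneq c 0; first by rewrite expr0n E00 mulr0.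
  have := h ((N - d + 1) / (2 * c)).
  rewrite E00 mulr0 addr0.
  have -> : 2 * ((N - d + 1) / (2 * c)) * c = N - d + 1 by field.
  lra.
have := h (c / E); set t := c / E.
have cE : c = t * E by rewrite /t divfK.
have Ep : 0 < E by rewrite lt_neqAle eq_sym En0.
rewrite cE => hh.
have -> : (t * E) ^+ 2 = (t ^+ 2 * E) * E by ring.
by rewrite ler_pM2r //; nra.
Qed.

(** The substitute for the projection theorem, in V * V with the sum of the inner
    products because that is where graphs of operators live.  A sequence in K
    minimizing the distance to (f, g) is Cauchy by the parallelogram identity.
    The residual of an almost minimizer is almost orthogonal to K, by
    [discriminant_le] applied to the distance along each direction of K; hence
    the limit of the residuals is orthogonal to K and vanishes. *)
Lemma dense_of_orthogonal_eq0 (K : set (V * V)) :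
  K (0, 0) ->
  (forall (a : R) p q, K p -> K q -> K (a%:C *: p.1 + q.1, a%:C *: p.2 + q.2)) ->
  (forall a b, (forall p, K p -> ip a p.1 + ip b p.2 = 0) -> a = 0 /\ b = 0) ->
  forall f g : V, exists k : nat -> V * V, [/\ forall n, K (k n),
    (k n).1 @[n --> \oo] --> f & (k n).2 @[n --> \oo] --> g].
Proof.
move=> K0 KP Kperp f g.
pose N p := sq (f - p.1) + sq (g - p.2).
have N0 p : 0 <= N p by rewrite addr_ge0 ?nsq_ge0.
pose d := inf [set N p | p in K].
have hinf : has_inf [set N p | p in K].
  by split; [exists (N (0, 0)), (0, 0) | exists 0 => _ [p _ <-]].
have dle p : K p -> d <= N p by move=> Kp; apply: ge_inf; [case: hinf | exists p].
have /choice[k hk] (n : nat) : exists p, K p /\ N p < d + n.+1%:R^-1.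
  have [|_ [p Kp <-] lt] := @inf_adherent _ _ n.+1%:R^-1 _ hinf.
    by rewrite invr_gt0.
  by exists p.
have Kk n : K (k n) by case: (hk n).
have Nk n : N (k n) - d <= n.+1%:R^-1.
  by have [_ /ltW] := hk n; rewrite lerBlDl.
(* The midpoint of two approximants is in K, so its distance is at least d. *)
have par n m : sq ((k n).1 - (k m).1) + sq ((k n).2 - (k m).2) <=
    2 * n.+1%:R^-1 + 2 * m.+1%:R^-1.
  have Kh : K ((2^-1)%:C *: (k n).1 + (2^-1)%:C *: (k m).1,
               (2^-1)%:C *: (k n).2 + (2^-1)%:C *: (k m).2).
    by have := KP 2^-1 _ _ (Kk n) (KP 2^-1 _ _ (Kk m) K0); rewrite /= !addr0.
  have := dle _ Kh; rewrite /N /= !opprD.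
  move: (Nk n) (Nk m); rewrite /N.
  rewrite !(nsqD dot, nsqN, nsqZ, ripDl, ripDr, ripNl, ripNr, ripZl, ripZr).
  move: (n.+1%:R^-1) (m.+1%:R^-1) => a b.
  lra.
have small (e : R) : 0 < e -> exists M, forall n m, (M <= n)%N -> (M <= m)%N ->
    sq ((k n).1 - (k m).1) + sq ((k n).2 - (k m).2) <= e.
  move=> e0.
  have [M hM] : exists M, forall n, (M <= n)%N -> n.+1%:R^-1 < e / 4 :> R.
    have /cvgr0Pnorm_lt/(_ (e / 4)) [|M _ hM] := @cvg_harmonic R; first lra.
    exists M => n /hM /=; rewrite ger0_norm //.
  exists M => n m /hM n1 /hM m1; apply: le_trans (par n m) _.
  move: (n.+1%:R^-1) (m.+1%:R^-1) n1 m1 => a b; lra.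
have [x kx] : exists x : V, (k n).1 @[n --> \oo] --> x.
  apply: (cvg_of_cauchy dot hdot) => e /small[M hM]; exists M => n m Mn Mm.
  have := hM n m Mn Mm; have := nsq_ge0 dot hdot ((k n).2 - (k m).2); lra.
have [y ky] : exists y : V, (k n).2 @[n --> \oo] --> y.
  apply: (cvg_of_cauchy dot hdot) => e /small[M hM]; exists M => n m Mn Mm.
  have := hM n m Mn Mm; have := nsq_ge0 dot hdot ((k n).1 - (k m).1); lra.
suff [fx gy] : f - x = 0 /\ g - y = 0.
  by exists k; rewrite (subr0_eq fx) (subr0_eq gy).
apply: Kperp => p Kp.
pose c n := ip (f - (k n).1) p.1 + ip (g - (k n).2) p.2.
have cn n : (c n) ^+ 2 <= (N (k n) - d) * (sq p.1 + sq p.2).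
  apply: discriminant_le => [|t]; first by rewrite addr_ge0 ?nsq_ge0.
  have := dle _ (KP t _ _ Kp (Kk n)).
  rewrite /N /c /= !opprD.
  rewrite !(nsqD dot, nsqN, nsqZ, ripDl, ripDr, ripNl, ripNr, ripZl, ripZr).
  rewrite (ripC dot p.1) (ripC dot p.2).
  rewrite ![ip _ p.1](ripC dot) ![ip _ p.2](ripC dot).
  lra.
have c0 : c n ^+ 2 @[n --> \oo] --> (0 : R).
  apply: (@squeeze_cvgr _ _ _ _ (fun=> 0) (fun n => n.+1%:R^-1 * (sq p.1 + sq p.2))).
  - near=> n; rewrite sqr_ge0 /=; apply: le_trans (cn n) _.
    by rewrite ler_wpM2r // addr_ge0 ?nsq_ge0.
  - exact: cvg_cst.
  - rewrite -(mul0r (sq p.1 + sq p.2)); apply: cvgMl; exact: cvg_harmonic.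
have c1 : c n @[n --> \oo] --> ip (f - x) p.1 + ip (g - y) p.2.
  by apply: cvgD; apply: cvg_rip => //; apply: cvgB => //; exact: cvg_cst.
have c2 : c n ^+ 2 @[n --> \oo] --> (ip (f - x) p.1 + ip (g - y) p.2) ^+ 2.
  by rewrite expr2; under eq_fun do rewrite expr2; exact: cvgM.
have e := cvg_unique (@Rhausdorff R) c2 c0.
by apply/eqP; rewrite -sqrf_eq0 e.
Unshelve. all: by end_near. Qed.

End GraphSpace.

(** * Self-adjoint operators and a Lax-Milgram theorem on their graphs *)

Section SelfAdjoint.
Context {R : realType} {V : completeNormedModType R[i]}.
Variable dot : {dot V for Num.conj}.
Hypothesis hdot : norm_of_dot dot.
Local Notation ip := (rip dot).
Local Notation sq := (nsq dot).

Lemma operatorB {S : set (V * V)} {x y u v : V} : is_operator S ->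
  S (x, u) -> S (y, v) -> S (x - y, u - v).
Proof.
move=> [_ lin _] xu yv; have := lin (-1) _ _ _ _ yv xu.
by rewrite !scaleN1r addrC [- v + u]addrC.
Qed.

Lemma operatorD {S : set (V * V)} {x y u v : V} : is_operator S ->
  S (x, u) -> S (y, v) -> S (x + y, u + v).
Proof.
by move=> [_ lin _] xu yv; have := lin 1 _ _ _ _ xu yv; rewrite !scale1r.
Qed.

Lemma operatorZ {S : set (V * V)} (a : R[i]) {x u : V} : is_operator S ->
  S (x, u) -> S (a *: x, a *: u).
Proof.
by move=> [S0 lin _] xu; have := lin a _ _ _ _ xu S0; rewrite !addr0.
Qed.

Lemma app_eq {S : set (V * V)} {x u : V} : is_operator S -> S (x, u) -> app S x = u.
Proof.
move=> [_ _ inj] xu; rewrite /app; case: xgetP => [w _|h]; first by move/inj; apply.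
by case: (h u).
Qed.

Lemma app_graph {S : set (V * V)} {x : V} : dom S x -> S (x, app S x).
Proof. exact: (@xgetPex _ 0 [set u | S (x, u)]). Qed.

Section One.
Variable S : set (V * V).
Hypothesis Ssa : selfadjoint dot S.

Lemma selfadjoint_op : is_operator S.
Proof. by case: Ssa. Qed.

Lemma selfadjoint_dot {x y u v} : S (x, u) -> S (y, v) -> dot u y = dot x v.
Proof. by case: Ssa => _ _ e xu; rewrite [in X in X -> _]e => /(_ _ _ xu). Qed.

Lemma selfadjoint_rip {x y u v} : S (x, u) -> S (y, v) -> ip u y = ip x v.
Proof. by move=> xu yv; rewrite /rip (selfadjoint_dot xu yv). Qed.

(** Replacing x by i x recovers the complex relation in the definition of the
    adjoint from its real part. *)
Lemma selfadjoint_intro y v : (forall x u, S (x, u) -> ip u y = ip x v) -> S (y, v).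
Proof.
move=> h; have [_ _ ->] := Ssa; move=> x u xu /=.
have h1 := h _ _ xu.
have h2 := h _ _ (operatorZ 'i%C selfadjoint_op xu).
move: h1 h2; rewrite !rip_iMl /rip.
by case: (dot u y) (dot x v) => a b [c d] /= -> /oppr_inj ->.
Qed.

Lemma selfadjoint_closed (x u : nat -> V) (l m : V) :
  (forall n, S (x n, u n)) -> x n @[n --> \oo] --> l -> u n @[n --> \oo] --> m ->
  S (l, m).
Proof.
move=> xu xl um; apply: selfadjoint_intro => y v yv.
have h1 := cvg_ripr dot hdot x l v xl.
have h2 := cvg_ripr dot hdot u m y um.
apply: (cvg_unique (@Rhausdorff R) h1).
by rewrite (_ : (fun n => ip v (x n)) = (fun n => ip y (u n))) //;
  apply/funext => n; rewrite (selfadjoint_rip yv (xu n)).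
Qed.

Lemma cvg_of_nsq_le (x : nat -> V) (g h : nat -> V) (a : R) (l m : V) :
  0 < a -> g n @[n --> \oo] --> l -> h n @[n --> \oo] --> m ->
  (forall n k, a * sq (x n - x k) <= sq (g n - g k) + sq (h n - h k)) ->
  exists z : V, x n @[n --> \oo] --> z.
Proof.
move=> a0 /(cvg_nsq dot hdot) gl /(cvg_nsq dot hdot) hm H.
apply: (cvg_of_cauchy dot hdot) => e e0.
have e1 : 0 < a * e / 8 by rewrite divr_gt0 // mulr_gt0.
move/cvgr0Pnorm_lt/(_ _ e1) : gl => [N _ hN].
move/cvgr0Pnorm_lt/(_ _ e1) : hm => [M _ hM].
have split2 (p : nat -> V) q n k : sq (p n - p k) <= 2 * (sq (p n - q) + sq (p k - q)).
  have -> : p n - p k = (p n - q) - (p k - q) by rewrite opprB addrA subrK.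
  move: (p n - q) (p k - q) => b c.
  have := nsq_ge0 dot hdot (b + c); rewrite nsqD nsqB; lra.
exists (maxn N M) => n k; rewrite !geq_max => /andP[Nn Mn] /andP[Nk Mk].
move: (hN n Nn) (hN k Nk) (hM n Mn) (hM k Mk) => /=.
rewrite !ger0_norm ?nsq_ge0 // => n1 n2 n3 n4.
have := H n k; have := split2 g l n k; have := split2 h m n k => h1 h2 h3.
have : a * sq (x n - x k) <= a * e by lra.
by rewrite ler_pM2l.
Qed.

(** Let M = (M1, M2) act on pairs and let Gr be the graph of S, whose orthogonal
    complement consists of the pairs (- v, w) with v = S w.  The claim is that
    (f, 0) belongs to M Gr + Gr^perp.  This subspace is dense: a pair orthogonal
    to it is orthogonal to Gr^perp, hence belongs to Gr as S is self-adjoint,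
    and coercivity against its image under J makes it zero.  It is closed:
    since J Gr = Gr is orthogonal to Gr^perp, coercivity bounds p by the norm of
    M p + q for p in Gr and q in Gr^perp. *)
Lemma lax_milgram_graph (J M1 M2 : {linear V -> V}) (a : R) :
  (forall x, J (J x) = x) -> (forall x, sq (J x) = sq x) ->
  (forall x u, S (x, u) -> S (J x, J u)) ->
  bounded_op M1 -> bounded_op M2 -> 0 < a ->
  (forall x u, S (x, u) -> a * (sq x + sq u) <= ip (J x) (M1 x) + ip (J u) (M2 u)) ->
  forall f, exists x u, S (x, u) /\ S (M2 u, f - M1 x).
Proof.
move=> JJ Jsq JS M1b M2b a0 coer f.
pose K : set (V * V) := [set p | exists x u w v,
  [/\ S (x, u), S (w, v) & p = (M1 x - v, M2 u + w)]].
have S0 : S (0, 0) by case: selfadjoint_op.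
have K0 : K (0, 0).
  exists 0, 0, 0, 0; split=> //.
  by rewrite (linear0 M1) (linear0 M2) subr0 addr0.
have KP (b : R) p q : K p -> K q -> K (b%:C *: p.1 + q.1, b%:C *: p.2 + q.2).
  move=> [x [u [w [v [xu wv ->]]]]] [x' [u' [w' [v' [xu' wv' ->]]]]] /=.
  have [_ lin _] := selfadjoint_op.
  exists (b%:C *: x + x'), (b%:C *: u + u'), (b%:C *: w + w'), (b%:C *: v + v').
  split; [exact: lin|exact: lin|].
  rewrite (linearP M1) (linearP M2) scalerBr scalerDr.
  by congr (_, _); rewrite ?opprD addrACA.
(* With x = 0 orthogonality to K says that (b, c) is on the graph of S. *)
have Kperp (b c : V) : (forall p, K p -> ip b p.1 + ip c p.2 = 0) -> b = 0 /\ c = 0.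
  move=> h.
  have bc : S (b, c).
    apply: selfadjoint_intro => w v wv.
    have /h /= : K (M1 0 - v, M2 0 + w) by exists 0, 0, w, v.
    rewrite (linear0 M1) (linear0 M2) sub0r add0r ripNr (ripC dot c) (ripC dot b); lra.
  have Jbc := JS _ _ bc.
  have /h /= : K (M1 (J b) - 0, M2 (J c) + 0) by exists (J b), (J c), 0, 0.
  have := coer _ _ Jbc; rewrite !JJ subr0 addr0 !Jsq => h1 h2.
  have := nsq_ge0 dot hdot b; have := nsq_ge0 dot hdot c => h3 h4.
  have : sq b + sq c <= 0 by rewrite -(pmulr_rle0 _ a0); lra.
  by move=> h5; split; apply: (nsq_eq0 dot hdot); lra.
have [k [Kk k1 k2]] := dense_of_orthogonal_eq0 dot hdot K K0 KP Kperp f 0.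
have /choice[x hx] (n : nat) : exists x, exists u w v,
  [/\ S (x, u), S (w, v) & k n = (M1 x - v, M2 u + w)] := Kk n.
have /choice[u hu] n := hx n.
have /choice[w hw] n := hu n.
have /choice[v hv] n := hw n.
have xu n : S (x n, u n) by case: (hv n).
have wv n : S (w n, v n) by case: (hv n).
have ke n : k n = (M1 (x n) - v n, M2 (u n) + w n) by case: (hv n).
(* Coercivity gives a |p|^2 <= <J p, g> for the differences p = (X, U) and g;
   nonnegativity of |a J p - g|^2 then bounds a^2 |p|^2 by |g|^2. *)
have key n m : a ^+ 2 * (sq (x n - x m) + sq (u n - u m)) <=
    sq ((k n).1 - (k m).1) + sq ((k n).2 - (k m).2).
  rewrite !ke /=.
  have Sx := operatorB selfadjoint_op (xu n) (xu m).
  have Sw := operatorB selfadjoint_op (wv n) (wv m).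
  have := coer _ _ Sx; have := selfadjoint_rip (JS _ _ Sx) Sw.
  move: Sx Sw; set X := x n - x m; set U := u n - u m => Sx Sw.
  have -> : M1 (x n) - v n - (M1 (x m) - v m) = M1 X - (v n - v m).
    by rewrite /X (linearB M1) !opprD !opprK addrACA.
  have -> : M2 (u n) + w n - (M2 (u m) + w m) = M2 U + (w n - w m).
    by rewrite /U (linearB M2) opprD addrACA.
  set p := M1 X - _; set q := M2 U + _ => e1 e2.
  have e3 : a * (sq X + sq U) <= ip (J X) p + ip (J U) q.
    by rewrite /p /q ripBr ripDr; lra.
  have JX := Jsq X; have JU := Jsq U.
  clear e1 e2; clearbody p q X U.
  have p1 := nsq_ge0 dot hdot (a%:C *: J X - p).
  have p2 := nsq_ge0 dot hdot (a%:C *: J U - q).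
  move: p1 p2; rewrite !nsqB !nsqZ !ripZl !Jsq => p1 p2.
  have : a * (a * (sq X + sq U)) <= a * (ip (J X) p + ip (J U) q) by rewrite ler_pM2l.
  lra.
have a2 : 0 < a ^+ 2 by rewrite exprn_gt0.
have [X xX] : exists z : V, x n @[n --> \oo] --> z.
  apply: (cvg_of_nsq_le x _ _ _ _ _ a2 k1 k2) => n m; apply: le_trans (key n m).
  by rewrite ler_pM2l // lerDl nsq_ge0.
have [U uU] : exists z : V, u n @[n --> \oo] --> z.
  apply: (cvg_of_nsq_le u _ _ _ _ _ a2 k1 k2) => n m; apply: le_trans (key n m).
  by rewrite ler_pM2l // lerDr nsq_ge0.
exists X, U; split; first exact: selfadjoint_closed xX uU.
have vl : v n @[n --> \oo] --> M1 X - f.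
  have -> : v = (fun n => M1 (x n) - (k n).1).
    by apply/funext => n; rewrite ke /= opprB addrC subrK.
  by apply: cvgB => //; exact: cvg_bounded_op xX.
have wl : w n @[n --> \oo] --> 0 - M2 U.
  have -> : w = (fun n => (k n).2 - M2 (u n)).
    by apply/funext => n; rewrite ke /= addrC addKr.
  by apply: cvgB => //; exact: cvg_bounded_op uU.
have := operatorZ (-1) selfadjoint_op (selfadjoint_closed _ _ _ _ wv wl vl).
by rewrite !scaleN1r sub0r opprK opprB.
Qed.

End One.
End SelfAdjoint.

(** * Uniqueness of bounded square roots *)

Section SquareRoot.
Context {R : realType} {V : completeNormedModType R[i]}.
Variable dot : {dot V for Num.conj}.
Hypothesis hdot : norm_of_dot dot.
Local Notation ip := (rip dot).
Local Notation sq := (nsq dot).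

(** For 0 <= P <= 1 one has P^2 <= P; positivity is used at x - P x. *)
Lemma nsq_le_rip (P : {linear V -> V}) x :
  (forall x y, ip (P x) y = ip x (P y)) -> (forall x, 0 <= ip (P x) x) ->
  (forall x, sq (P x) <= sq x) -> sq (P x) <= ip (P x) x.
Proof.
move=> sym pos bd.
have := pos (x - P x); have := bd (P x).
have := nsq_ge0 dot hdot (P (P x) - P x).
rewrite nsqB (linearB P) !(ripBl, ripBr) (sym (P x) x) -/(sq (P x)).
lra.
Qed.

(** Put C = P + Q >= 0 and D = P - Q.  Then C D = - D C, so that
    D (lam - C) = (lam + C) D for lam > 0.  Let m be the square of the norm of D
    and let x be a unit vector with |D x|^2 close to m.  Comparing
    |(lam + C) D x|^2 >= lam^2 |D x|^2 with m |(lam - C) x|^2 shows that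
    <C x, x> is small.  But |D x|^2 <= 2 <C x, x> by [nsq_le_rip], so m = 0. *)
Lemma bounded_sqrt_unique (P Q : {linear V -> V}) :
  (forall x y, ip (P x) y = ip x (P y)) -> (forall x, 0 <= ip (P x) x) ->
  (forall x, sq (P x) <= sq x) ->
  (forall x y, ip (Q x) y = ip x (Q y)) -> (forall x, 0 <= ip (Q x) x) ->
  (forall x, sq (Q x) <= sq x) ->
  (forall x, P (P x) = Q (Q x)) -> forall x, P x = Q x.
Proof.
move=> Psym Ppos Pbd Qsym Qpos Qbd PQ.
pose D x := P x - Q x; pose C x := P x + Q x.
have Dle x : sq (D x) <= 2 * ip (C x) x.
  have := nsq_ge0 dot hdot (P x + Q x).
  have := nsq_le_rip P x Psym Ppos Pbd; have := nsq_le_rip Q x Qsym Qpos Qbd.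
  rewrite /D /C nsqB nsqD ripDl; lra.
have Cle x : sq (C x) <= 4 * sq x.
  have := nsq_ge0 dot hdot (P x - Q x); have := Pbd x; have := Qbd x.
  rewrite /C nsqB nsqD; lra.
have D4 x : sq (D x) <= 4 * sq x.
  have := nsq_ge0 dot hdot (P x + Q x); have := Pbd x; have := Qbd x.
  rewrite /D nsqB nsqD; lra.
pose E := [set sq (D x) | x in [set x | sq x <= 1]].
have hE : has_sup E.
  split; first by exists (sq (D 0)), 0 => //=; rewrite nsq0.
  by exists 4 => _ [x /= x1 <-]; apply: le_trans (D4 x) _; lra.
pose m := sup E.
have m0 : 0 <= m.
  apply: (@le_trans _ _ (sq (D 0))); first exact: nsq_ge0.
  by apply: ub_le_sup; [case: hE | exists 0 => //=; rewrite nsq0].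
have Dm x : sq (D x) <= m * sq x.
  have [->|x0] := eqVneq x 0.
    by rewrite /D (linear0 P) (linear0 Q) subr0 nsq0 mulr0.
  have sx : 0 < sq x.
    rewrite lt_neqAle nsq_ge0 // andbT eq_sym.
    by apply: contra_neq x0; exact: nsq_eq0.
  have : sq (D ((rnorm dot x)^-1%:C *: x)) <= m.
    apply: ub_le_sup; first by case: hE.
    exists ((rnorm dot x)^-1%:C *: x) => //=.
    by rewrite nsqZ exprVn sqr_rnorm // mulVf // gt_eqF.
  rewrite /D (linearZ_LR P) (linearZ_LR Q) /= -scalerBr -/(D x) nsqZ exprVn sqr_rnorm //.
  by rewrite mulrC ler_pdivrMr.
suff me : m = 0.
  move=> x; apply/eqP; rewrite -subr_eq0; apply/eqP.
  apply: (nsq_eq0 dot hdot); apply/eqP.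
  by rewrite eq_le nsq_ge0 // andbT; have := Dm x; rewrite me mul0r.
apply/eqP; rewrite eq_le m0 andbT leNgt; apply/negP => mp.
have m2p : 0 < m ^+ 2 by rewrite exprn_gt0.
(* The comparison reads m (1 - eps) < lam eps + 4 / lam; with lam = 8 / m the
   last term is m / 2, and this eps makes the first one too small. *)
pose eps := m ^+ 2 / (4 * (m ^+ 2 + 8)).
have eps0 : 0 < eps by rewrite divr_gt0 //; lra.
have [_ [x /= x1 <-] Dx] := sup_adherent (mulr_gt0 mp eps0) hE.
pose lam := 8 / m.
have lam0 : 0 < lam by rewrite divr_gt0.
pose w := P (D x) + Q (D x).
have w0 : 0 <= ip (D x) w.
  by rewrite ripDr addr_ge0 // -?Psym -?Qsym.
have CD : D (lam%:C *: x - C x) = lam%:C *: D x + w.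
  rewrite /D (linearB P) (linearB Q) (linearZ_LR P) (linearZ_LR Q) /= /w /C /D.
  rewrite !(linearB P, linearD P) !(linearB Q, linearD Q) PQ scalerBr.
  set a := lam%:C *: P x; set b := lam%:C *: Q x.
  set c := Q (Q x); set d := P (Q x); set e := Q (P x).
  rewrite !opprD !opprK.
  rewrite [LHS](AC ((1*2)*(1*2)) (((1*4)*(5*3))*(6*2))) /=.
  by rewrite [RHS](AC (2*(2*2)) (((1*2)*(5*4))*(3*6))) /=.
have := Dm (lam%:C *: x - C x).
have := nsq_ge0 dot hdot w.
move: Dx (Dle x) (Cle x) w0; rewrite -/m CD.
rewrite (nsqD dot _ w) (nsqB dot _ (C x)) !nsqZ !ripZl (ripC dot (C x)).
move: x1; set sx := sq x; set dx := sq (D x); set cx := sq (C x).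
set c := ip x (C x); set wd := ip _ w; set ww := sq w.
move=> x1 Dx Dc Cc w0 ww0 main.
clearbody sx dx cx c wd ww.
have lm : lam * m = 8 by rewrite /lam divfK // gt_eqF.
have em : eps * (4 * (m ^+ 2 + 8)) = m ^+ 2.
  by rewrite /eps divfK // gt_eqF //; lra.
have h1 : lam ^+ 2 * (m - m * eps) <= m * (lam ^+ 2 - 2 * (lam * c) + 4).
  apply: (@le_trans _ _ (lam ^+ 2 * dx)).
    by rewrite ler_pM2l ?exprn_gt0 //; exact: ltW.
  apply: (@le_trans _ _ (m * (lam ^+ 2 * sx - 2 * (lam * c) + cx))).
    have := mulr_ge0 (ltW lam0) w0; lra.
  rewrite ler_pM2l //.
  have : lam ^+ 2 * sx <= lam ^+ 2 * 1 by rewrite ler_pM2l ?exprn_gt0.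
  lra.
have h2 : lam ^+ 2 * (1 - eps) <= lam ^+ 2 - 2 * (lam * c) + 4.
  by rewrite -(ler_pM2l mp); lra.
have h3 : lam * (m - m * eps) < lam * (2 * c).
  by rewrite ltr_pM2l //; lra.
have h4 : lam * (m - m * eps) < lam ^+ 2 * eps + 4 by lra.
have h5 : 8 * (1 - eps) < lam ^+ 2 * eps + 4.
  by rewrite -lm; lra.
have h6 : m ^+ 2 * (8 * (1 - eps)) < m ^+ 2 * (lam ^+ 2 * eps + 4).
  by rewrite ltr_pM2l.
have h7 : m ^+ 2 * (lam ^+ 2 * eps) = 64 * eps.
  by rewrite mulrA -exprMn [m * lam]mulrC lm; ring.
lra.
Qed.

End SquareRoot.

(** * Operators commuting with a square commute with the square root *)

Section Commutation.
Context {R : realType} {V : completeNormedModType R[i]}.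
Variable dot : {dot V for Num.conj}.
Hypothesis hdot : norm_of_dot dot.
Local Notation ip := (rip dot).
Local Notation sq := (nsq dot).
Variable S : set (V * V).
Hypothesis Ssa : selfadjoint dot S.

Let Sop := selfadjoint_op dot S Ssa.
Let Ssym {x y u v} := @selfadjoint_rip _ _ dot S Ssa x y u v.

Lemma resolvent_unique x u x' u' f :
  S (x, u) -> S (u, f - x) -> S (x', u') -> S (u', f - x') -> x = x' /\ u = u'.
Proof.
move=> xu ux xu' ux'.
have h1 := operatorB Sop xu xu'; have := operatorB Sop ux ux'.
have -> : f - x - (f - x') = - (x - x').
  by rewrite addrAC !opprB [f + _]addrC subrK.
move=> /(Ssym h1); rewrite ripNr => e.
have := nsq_ge0 dot hdot (x - x'); have := nsq_ge0 dot hdot (u - u') => p1 p2.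
by split; apply/subr0_eq/(nsq_eq0 dot hdot); move: e p1 p2; rewrite /nsq; lra.
Qed.

(** r = (S S + 1)^-1 and q = S (S S + 1)^-1, by [lax_milgram_graph] with all the
    bounded operators equal to the identity. *)
Lemma resolvent_exists : exists r q : {linear V -> V},
  forall f, S (r f, q f) /\ S (q f, f - r f).
Proof.
have idb : bounded_op (idfun : V -> V) by exists 1 => x; rewrite mul1r.
have ex f : exists p : V * V, S (p.1, p.2) /\ S (p.2, f - p.1).
  pose I : {linear V -> V} := idfun.
  have coer x u : S (x, u) -> 1 * (sq x + sq u) <= ip (I x) (I x) + ip (I u) (I u).
    by rewrite mul1r.
  have [||| x [u [xu ux]]] := @lax_milgram_graph _ _ dot hdot S Ssa I I I 1
    _ _ _ idb idb ltr01 coer f => //.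
  by exists (x, u).
have [p hp] := choice ex.
have lin (a : R[i]) f g : p (a *: f + g) = (a *: (p f).1 + (p g).1, a *: (p f).2 + (p g).2).
  have [h1 h2] := hp (a *: f + g); have [h3 h4] := hp f; have [h5 h6] := hp g.
  rewrite [LHS]surjective_pairing.
  have h7 := operatorD Sop (operatorZ a Sop h3) h5.
  have h8 : S (a *: (p f).2 + (p g).2, a *: f + g - (a *: (p f).1 + (p g).1)).
    rewrite opprD addrACA -scalerBr.
    exact: (operatorD Sop (operatorZ a Sop h4) h6).
  by have [-> ->] := resolvent_unique _ _ _ _ _ h1 h2 h7 h8.
have l1 : linear (fun f => (p f).1) by move=> a f g; rewrite lin.
have l2 : linear (fun f => (p f).2) by move=> a f g; rewrite lin.
pose r : {linear V -> V} := HB.pack (fun f => (p f).1) (GRing.isLinear.Build _ _ _ _ _ l1).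
pose q : {linear V -> V} := HB.pack (fun f => (p f).2) (GRing.isLinear.Build _ _ _ _ _ l2).
by exists r, q.
Qed.

Section Resolvent.
Variables r q : {linear V -> V}.
Hypothesis rqP : forall f, S (r f, q f) /\ S (q f, f - r f).

(** The orthogonal projection onto the graph of S maps (x, u) to
    (r x + q u, q x + u - r u), and the graph is its set of fixed points. *)
Lemma graph_resolvent x u : S (x, u) <-> x = r x + q u /\ q x = r u.
Proof.
split=> [xu|[ex eu]].
  have [h1 h2] := rqP x.
  have h3 := operatorB Sop xu h1.
  have [h4 h5] := rqP u.
  have [e1 e2] := resolvent_unique _ _ _ _ _ h2 h3 h4 h5.
  by rewrite -e2 addrC subrK.
have [h1 _] := rqP x; have [_ h2] := rqP u.
have := operatorD Sop h1 h2.
by rewrite -ex eu addrC subrK.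
Qed.

Lemma resolvent_sqr f : q (q f) = r f - r (r f).
Proof.
have [h _] := rqP f.
by have [e _] := proj1 (graph_resolvent _ _) h; apply/eqP; rewrite eq_sym subr_eq addrC -e.
Qed.

Lemma resolvent_sym f g : ip (q f) g = ip f (q g).
Proof.
have [h1 h2] := rqP f; have [h3 h4] := rqP g.
have := Ssym h1 h3; have := Ssym h2 h4.
rewrite !(ripBl, ripBr); lra.
Qed.

Lemma resolvent_bound f : sq (q f) <= sq f.
Proof.
have [h1 h2] := rqP f; have := Ssym h1 h2.
have := nsq_ge0 dot hdot (r f); have := nsq_ge0 dot hdot (f - r f).
have := nsq_ge0 dot hdot f.
rewrite nsqB ripBr -!/(sq _) (ripC dot (r f)) => ? ? ? ?; lra.
Qed.

Lemma resolvent_pos f :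
  (forall x u, S (x, u) -> 0 <= ip u x) -> 0 <= ip (q f) f.
Proof.
move=> pos; have [h1 h2] := rqP f.
have := pos _ _ h1; have := pos _ _ h2; rewrite ripBl (ripC dot f) (ripC dot (q f) (r f)); lra.
Qed.
End Resolvent.

(** J commutes with r because it commutes with S S.  Both q and J q J are
    nonnegative square roots of r - r^2, hence equal, so J commutes with q as
    well and therefore preserves the graph of S by [graph_resolvent]. *)
Lemma commutes_sqrt (J : {linear V -> V}) :
  (forall x u, S (x, u) -> 0 <= ip u x) ->
  (forall x, J (J x) = x) -> (forall x y, ip (J x) y = ip x (J y)) ->
  (forall x u v, S (x, u) -> S (u, v) -> exists2 w, S (J x, w) & S (w, J v)) ->
  forall x u, S (x, u) -> S (J x, J u).
Proof.
move=> pos JJ Jsym JA.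
have [r [q rqP]] := resolvent_exists.
have Jsq x : sq (J x) = sq x by rewrite /nsq Jsym JJ.
have rJ f : r (J f) = J (r f).
  have [h1 h2] := rqP f; have [w h3 h4] := JA _ _ _ h1 h2.
  have [h5 h6] := rqP (J f).
  rewrite (linearB J) in h4.
  by have [] := resolvent_unique _ _ _ _ _ h5 h6 h3 h4.
have qJ f : q (J f) = J (q f).
  have -> : q (J f) = J (q (J (J f))); last by rewrite JJ.
  apply: (@bounded_sqrt_unique _ _ dot hdot q (J \o q \o J)).
  - exact: resolvent_sym rqP.
  - by move=> x; exact: resolvent_pos rqP x pos.
  - exact: resolvent_bound rqP.
  - by move=> x y /=; rewrite Jsym (resolvent_sym _ _ rqP) Jsym.
  - by move=> x /=; rewrite Jsym; exact: resolvent_pos rqP _ pos.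
  - by move=> x /=; rewrite Jsq -(Jsq x); exact: resolvent_bound rqP _.
  - move=> x /=; rewrite JJ !(resolvent_sqr _ _ rqP) !rJ -(linearB J) JJ; congr (_ - _).
move=> x u /(graph_resolvent _ _ rqP) [e1 e2]; apply/(graph_resolvent _ _ rqP).
by rewrite rJ !qJ rJ e2 -(linearD J) -e1.
Qed.

End Commutation.

(** * The operator S H S *)

Section ProductOperator.
Context {R : realType} {V : completeNormedModType R[i]}.
Variable dot : {dot V for Num.conj}.
Hypothesis hdot : norm_of_dot dot.
Local Notation ip := (rip dot).
Local Notation sq := (nsq dot).

Lemma dense_dom_of_orthogonal_eq0 (G : set (V * V)) : is_operator G ->
  (forall g, (forall x, dom G x -> ip g x = 0) -> g = 0) -> dense (dom G).
Proof.
move=> Gop perp O [g Og] oO.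
pose K : set (V * V) := [set p | dom G p.1].
have [||| k [Kk k1 _]] := dense_of_orthogonal_eq0 dot hdot K _ _ _ g 0.
- by exists 0; case: Gop.
- move=> a p q [u pu] [v qv]; exists (a%:C *: u + v).
  by case: Gop => _ lin _; exact: lin.
- move=> a b h; split; apply: perp.
    move=> x Gx; have := h (x, 0) Gx.
    by rewrite /= rip0r addr0.
  have b0 : b = 0.
    apply: (rip_eq0 dot hdot) => y; have := h (0, y).
    rewrite /= rip0r add0r; apply; exists 0; by case: Gop.
  by move=> x _; rewrite b0 rip0l.
have : nbhs g O by exact: open_nbhs_nbhs.
move=> /k1 [N _ hN]; exists (k N).1; split; last exact: Kk.
by apply: hN => /=.
Qed.

Variables (J H : {linear V -> V}) (alpha : R).
Hypothesis H_sym : forall x y, dot (H x) y = dot x (H y).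
Hypothesis J_sym : forall x y, dot (J x) y = dot x (J y).
Hypothesis JJ : forall x, J (J x) = x.

(** Write x = p + q with J p = p and J q = - q.  In <p - q, H (p + q)> the terms
    <p, H q> and - <q, H p> have opposite real parts. *)
Lemma indefinite_coercive :
  form_le dot (fun x => alpha%:C *: proj_pos J x) (proj_pos J \o H \o proj_pos J) ->
  form_le dot (proj_neg J \o H \o proj_neg J) (fun x => - alpha%:C *: proj_neg J x) ->
  forall x, alpha * sq x <= ip (J x) (H x).
Proof.
move=> Hp Hn x.
have half : 2^-1 = (2^-1)%:C :> R[i] by rewrite fmorphV rmorph_nat.
have Psym y z : ip (proj_pos J y) z = ip y (proj_pos J z).
  by rewrite /proj_pos !half ripZl ripZr ripDl ripDr; congr (_ * (_ + _)); rewrite /rip J_sym.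
have Nsym y z : ip (proj_neg J y) z = ip y (proj_neg J z).
  by rewrite /proj_neg ripBl ripBr Psym.
have := Hn x; have := Hp x; rewrite !lecE => /andP[_ h1] /andP[_ h2].
move: h1 h2; rewrite -!/(ip _ _) /= Psym Nsym ripZl.
rewrite -rmorphN ripZl.
have eJ : J x = proj_pos J x - proj_neg J x.
  rewrite /proj_neg opprB addrA /proj_pos -scalerDl.
  have -> : 2^-1 + 2^-1 = 1 :> R[i] by field.
  by rewrite scale1r addrK.
have ex : x = proj_pos J x + proj_neg J x by rewrite /proj_neg addrC subrK.
rewrite eJ; move: ex; set p := proj_pos J x; set q := proj_neg J x.
move=> ex; rewrite {}ex; clearbody p q.
rewrite (linearD H) nsqD !(ripDl, ripDr, ripNl) -!/(sq _).
have e : ip (H p) q = ip p (H q) by rewrite /rip H_sym.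
rewrite (ripC dot q (H p)) (ripC dot p (H p)) (ripC dot q (H q)) (ripC dot q p) e.
lra.
Qed.

Variable S : set (V * V).
Hypothesis Ssa : selfadjoint dot S.
Hypothesis JS : forall x u, S (x, u) -> S (J x, J u).
Hypothesis coer : forall x, alpha * sq x <= ip (J x) (H x).
Hypothesis alpha_gt0 : 0 < alpha.
Hypothesis alpha_le1 : alpha <= 1.
Hypothesis Hb : bounded_op H.
Hypothesis Jb : bounded_op J.

Local Notation SHS := (op_comp S (op_comp (graph H) S)).

Lemma sandwichP x v : SHS (x, v) <-> exists2 u, S (x, u) & S (H u, v).
Proof.
split=> [[y [[u [xu e]] yv]]|[u xu uv]].
  by exists u => //; have <- : y = H u := e.
by exists (H u); split=> //; exists u.
Qed.

Lemma sandwich_sym x v y w : SHS (x, v) -> SHS (y, w) -> dot v y = dot x w.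
Proof.
move=> /sandwichP[u xu uv] /sandwichP[t yt tw].
by rewrite (selfadjoint_dot dot S Ssa uv yt) H_sym (selfadjoint_dot dot S Ssa xu tw).
Qed.

Lemma sandwich_op : is_operator SHS.
Proof.
have Sop := selfadjoint_op dot S Ssa; have [S0 lin inj] := Sop; split.
- by apply/sandwichP; exists 0; rewrite ?(linear0 H).
- move=> a x y u v /sandwichP[x' h1 h2] /sandwichP[y' h3 h4].
  apply/sandwichP; exists (a *: x' + y'); first exact: lin.
  by rewrite (linearP H); exact: lin.
- move=> x u v /sandwichP[x' h1 h2] /sandwichP[y' h3 h4].
  by move: h2; rewrite (inj _ _ _ h1 h3) => h2; exact: inj h2 h4.
Qed.

(** [lax_milgram_graph] with M1 = J and M2 = H.  Testing against J x and
    S J x = J S x gives real part at least alpha (|x|^2 + |S x|^2): the shift by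
    J makes the form coercive in the first component, where alpha <= 1 enters. *)
Lemma sandwich_shift_surj f : exists2 x, dom SHS x & exists2 v, SHS (x, v) & v + J x = f.
Proof.
have Jsq x : sq (J x) = sq x by rewrite /nsq /rip J_sym JJ.
have [|x [u [xu uv]]] := @lax_milgram_graph _ _ dot hdot S Ssa J J H alpha
   JJ Jsq JS Jb Hb alpha_gt0 _ f.
  move=> x u xu; rewrite mulrDr; apply: lerD; last exact: coer.
  rewrite -/(sq _) Jsq.
  by rewrite ler_piMl // nsq_ge0.
have xv : SHS (x, f - J x) by apply/sandwichP; exists u.
by exists x; [exists (f - J x)|exists (f - J x) => //; rewrite subrK].
Qed.

(** A symmetric operator which is onto has no proper symmetric extension: solve
    (S H S + J) y = w; then x - y is orthogonal to the whole range. *)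
Lemma sandwich_shift_inj x w :
  (forall y v, SHS (y, v) -> dot (v + J y) x = dot y w) ->
  SHS (x, w - J x).
Proof.
move=> h.
have [y _ [v yv e]] := sandwich_shift_surj w.
suff xy : x - y = 0 by rewrite (subr0_eq xy) -e addrK.
apply: (rip_eq0 dot hdot) => z.
have [t _ [s ts <-]] := sandwich_shift_surj z.
rewrite ripC /rip linearBr /= (h _ _ ts) linearDl /=.
rewrite (sandwich_sym _ _ _ _ ts yv) J_sym -e linearDr /=.
by rewrite subrr.
Qed.

Lemma sandwich_selfadjoint : selfadjoint dot SHS.
Proof.
split; first exact: sandwich_op.
  apply: dense_dom_of_orthogonal_eq0; first exact: sandwich_op.
  move=> g hg.
  have [x dx [w xw e]] := sandwich_shift_surj g.
  have x0 : x = 0.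
    apply: (rip_eq0 dot hdot) => z.
    have [t dt [s ts <-]] := sandwich_shift_surj z.
    have := hg _ dt; rewrite -e => <-.
    rewrite ripC /rip linearDl linearDl /= (sandwich_sym _ _ _ _ ts xw) J_sym.
    by rewrite -linearDr /= -[LHS]/(ip t (w + J x)) ripC /rip linearDl.
  have : w = 0.
    by have [h0 _ inj] := sandwich_op; apply: inj h0; rewrite -x0.
  by move=> w0; rewrite -e w0 x0 (linear0 J) addr0.
apply/seteqP; split=> [[y w] yw x u xu|[y w] h] /=; first exact: sandwich_sym yw.
have := sandwich_shift_inj y (w + J y); rewrite addrK; apply.
move=> x v xv; have := h x v xv => /= e.
by rewrite linearDl linearDr /= e J_sym.
Qed.

Lemma sandwich_represents : represents dot S H SHS.
Proof.
have Sop := selfadjoint_op dot S Ssa.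
split; first exact: sandwich_selfadjoint.
  by move=> x [v /sandwichP[u xu _]]; exists u.
move=> x y [u xu] [v yv]; rewrite /form_of (app_eq Sop xu) (app_eq sandwich_op yv).
move: yv => /sandwichP[w yw wv].
by rewrite (app_eq Sop yw) (selfadjoint_dot dot S Ssa xu wv).
Qed.

(** The defining relation says that H S y is in the domain of the adjoint of S,
    which gives B contained in S H S; then S H S is contained in the adjoint of
    B, which is B. *)
Lemma represents_unique B : represents dot S H B -> B = SHS.
Proof.
move=> [Bsa dBS rep].
have Sop := selfadjoint_op dot S Ssa; have Bop := selfadjoint_op dot B Bsa.
have sub : B `<=` SHS.
  move=> [y v] yv; have [u yu] : dom S y by apply: dBS; exists v.
  apply/sandwichP; exists u => //; apply: (selfadjoint_intro dot S Ssa) => x w xw.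
  have := rep x y (ex_intro _ w xw) (ex_intro _ v yv).
  by rewrite /form_of (app_eq Sop xw) (app_eq Sop yu) (app_eq Bop yv) /rip => ->.
apply/seteqP; split=> // [[y v] yv].
by case: Bsa => _ _ ->; move=> x u /sub xu /=; exact: sandwich_sym xu yv.
Qed.

End ProductOperator.

(** * A closed graph theorem by gliding hump *)

Section ClosedGraph.
Context {R : realType} {V : completeNormedModType R[i]}.
Variable dot : {dot V for Num.conj}.
Hypothesis hdot : norm_of_dot dot.
Local Notation ip := (rip dot).
Local Notation sq := (nsq dot).
Local Notation nrm := (rnorm dot).

Variables S T : set (V * V).
Hypothesis Ssa : selfadjoint dot S.
Hypothesis Top : is_operator T.
Hypothesis T_closed : forall (x u : nat -> V) (l : V) (C : R),
  (forall n, T (x n, u n)) -> (forall n, nrm (u n) <= C) ->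
  x n @[n --> \oo] --> l -> dom T l.
Hypothesis TS : dom T `<=` dom S.

Let Sop := selfadjoint_op dot S Ssa.

Lemma rnormZ (a : R) x : nrm (a%:C *: x) = `|a| * nrm x.
Proof. by rewrite /rnorm nsqZ sqrtrM ?sqr_ge0 // sqrtr_sqr. Qed.

Lemma dense_dom_approx (w : V) (e : R) : 0 < e ->
  exists2 z, dom S z & nrm (w - z) <= e.
Proof.
move=> e0; have [_ dS _] := Ssa.
have ec : 0 < e%:C by rewrite ltcR.
have [|z [zw zS]] := dS (ball w e%:C) _ (ball_open w e%:C).
  by exists w; exact: ballxx.
exists z => //; move: zw; rewrite -ball_normE /= (rnormE dot hdot) ltcR.
exact: ltW.
Qed.

(** Normalize a vector on which S is much larger than the graph norm of T, and
    detect the size of its image by a vector z of the dense domain of S, so that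
    the resulting functional <y, S z> is continuous for the norm of V. *)
Lemma unbounded_step :
  (forall C : R, exists y v w, [/\ T (y, v), S (y, w) & C * (sq y + sq v) < sq w]) ->
  forall d M : R, 0 < d -> 0 < M -> exists y v z s,
    [/\ T (y, v), S (z, s), nrm y <= d, nrm v <= d & nrm z <= 1 /\ M <= `|ip y s|].
Proof.
move=> unb d M' d0 M'0; pose M := 4 * M'.
have M0 : 0 < M by rewrite /M; lra.
have [y [v [w [yv yw lt]]]] := unb ((M / d) ^+ 2).
have w0 : 0 < sq w.
  apply: le_lt_trans lt; rewrite mulr_ge0 ?sqr_ge0 //.
  by rewrite addr_ge0 ?nsq_ge0.
have nw0 : 0 < nrm w by rewrite /rnorm sqrtr_gt0.
pose t := M / nrm w.
have t0 : 0 < t by rewrite divr_gt0.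
have small : sq (t%:C *: y) + sq (t%:C *: v) <= d ^+ 2.
  rewrite !nsqZ -mulrDr /t exprMn exprVn sqr_rnorm // mulrAC ler_pdivrMr //.
  move: lt; rewrite exprMn exprVn mulrAC ltr_pdivrMr ?exprn_gt0 // => /ltW.
  by rewrite [sq w * _]mulrC.
have nw : nrm (t%:C *: w) = M.
  by rewrite rnormZ gtr0_norm // /t divfK // gt_eqF.
have M2 : 0 < M / 2 by lra.
have [z [s zs] wz] := dense_dom_approx (t%:C *: w) (M / 2) M2.
have tyw := operatorZ t%:C Sop yw.
have tyv := operatorZ t%:C Top yv.
exists (t%:C *: y), (t%:C *: v), ((2 * M)^-1%:C *: z), ((2 * M)^-1%:C *: s).
have M20 : 0 < 2 * M by lra.
split=> //.
- exact: (operatorZ _ Sop zs).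
- apply: rnorm_le => //; first exact: ltW.
  by have := nsq_ge0 dot hdot (t%:C *: v); lra.
- apply: rnorm_le => //; first exact: ltW.
  by have := nsq_ge0 dot hdot (t%:C *: y); lra.
split.
  rewrite rnormZ gtr0_norm ?invr_gt0 // mulrC ler_pdivrMr //.
  have -> : z = t%:C *: w + - (t%:C *: w - z) by rewrite opprB addrC subrK.
  have := rnormD dot hdot (t%:C *: w) (- (t%:C *: w - z)).
  rewrite rnormN nw; lra.
rewrite -(selfadjoint_rip dot S Ssa tyw (operatorZ _ Sop zs)) ripZr normrM.
rewrite gtr0_norm ?invr_gt0 //.
rewrite mulrC ler_pdivlMr //.
have e : ip (t%:C *: w) z = M ^+ 2 - ip (t%:C *: w) (t%:C *: w - z).
  by rewrite ripBr -/(sq _) -sqr_rnorm // nw; lra.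
have := rip_le_rnorm dot hdot (t%:C *: w) (t%:C *: w - z).
rewrite nw => h; rewrite e.
have h2 : M * nrm (t%:C *: w - z) <= M * (M / 2) by rewrite ler_pM2l.
have h3 := le_trans (ler_norm _) (le_trans h h2).
apply: le_trans (ler_norm _).
have : M' * (2 * M) = M ^+ 2 / 2 by rewrite /M; field.
move=> ->; lra.
Qed.

(** Add up vectors y_n of rapidly decreasing graph norm of T, with signs chosen
    so that the n-th partial sum x_n satisfies n <= |<x_n, S z_n>|.  Each
    later y_k is taken small with respect to |S z_n|, so that the limit X
    satisfies n - 1 <= |<X, S z_n>| = |<S X, z_n>| <= |S X| for every n. *)
Lemma gliding_hump :
  (forall C : R, exists y v w, [/\ T (y, v), S (y, w) & C * (sq y + sq v) < sq w]) ->
  False.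
Proof.
move=> unb.
(* A state is (x, u, d): a partial sum x, its image u under T and the bound d
   for the next increment. *)
pose good (p : V * V * R) := T p.1 /\ 0 < p.2.
pose rel (n : nat) (p p' : V * V * R) := [/\ good p',
  nrm (p'.1.1 - p.1.1) <= p.2, nrm (p'.1.2 - p.1.2) <= p.2, p'.2 <= p.2 / 2 &
  exists z s, [/\ S (z, s), nrm z <= 1, n.+1%:R <= `|ip p'.1.1 s| &
    nrm s * p'.2 <= 3^-1]].
have step n p : exists p', good p -> rel n p p'.
  have [gp|] := pselect (good p); last by exists p.
  case: gp => Tp p0.
  have [y [v [z [s [yv zs ny nv [nz big]]]]]] :=
    unbounded_step unb p.2 n.+1%:R p0 (ltr0Sn _ _).
  pose d' := Num.min (p.2 / 2) (3 * (1 + nrm s))^-1.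
  have s1 : 0 < 1 + nrm s by have := rnorm_ge0 dot s; lra.
  have d'0 : 0 < d' by rewrite /d' lt_min; apply/andP; split; [lra|rewrite invr_gt0; lra].
  have sd' : nrm s * d' <= 3^-1.
    apply: (@le_trans _ _ (nrm s * (3 * (1 + nrm s))^-1)).
      by rewrite ler_wpM2l ?rnorm_ge0 // ge_min lexx orbT.
    by rewrite invfM mulrCA ler_piMr // ler_pdivrMr // mul1r; lra.
  have d'2 : d' <= p.2 / 2 by rewrite ge_min lexx.
  have tri : 2 * n.+1%:R <= `|ip (p.1.1 + y) s| + `|ip (p.1.1 - y) s|.
    rewrite ripDl ripBl.
    have := ler_normB (ip p.1.1 s + ip y s) (ip p.1.1 s - ip y s).
    have -> : ip p.1.1 s + ip y s - (ip p.1.1 s - ip y s) = 2 * ip y s by ring.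
    by rewrite normrM ger0_norm //; lra.
  have Tp' : T (p.1.1, p.1.2) by rewrite -surjective_pairing.
  have [h|h] := lerP (n.+1%:R) `|ip (p.1.1 + y) s|.
    exists (p.1.1 + y, p.1.2 + v, d') => _; split=> //=.
    - by split=> //=; exact: operatorD Top Tp' yv.
    - by rewrite addrC addKr.
    - by rewrite addrC addKr.
    - by exists z, s.
  exists (p.1.1 - y, p.1.2 - v, d') => _; split=> //=.
  - by split=> //=; exact: operatorB Top Tp' yv.
  - by rewrite addrC addKr rnormN.
  - by rewrite addrC addKr rnormN.
  - by exists z, s; split=> //; lra.
have [F hF] := choice (fun q : nat * (V * V * R) => step q.1 q.2).
pose p := fix p n := if n is m.+1 then F (m, p m) else ((0, 0), 1) : V * V * R.
have gp n : good (p n).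
  elim: n => [|n IH] /=; first by split=> //=; case: Top.
  by case: (hF (n, p n) IH).
have relp n : rel n (p n) (p n.+1) by exact: hF (n, p n) (gp n).
pose x n := (p n).1.1; pose u n := (p n).1.2; pose d n := (p n).2.
have d0 n : 0 < d n by case: (gp n).
have dS n : d n.+1 <= d n / 2 by case: (relp n).
have tail (f : nat -> V) : (forall n, nrm (f n.+1 - f n) <= d n) ->
    forall n k, nrm (f (n + k)%N - f n) <= 2 * d n - 2 * d (n + k)%N.
  move=> hf n; elim=> [|k IH].
    by rewrite addn0 !subrr /rnorm nsq0 sqrtr0.
  rewrite addnS.
  have -> : f (n + k).+1 - f n = (f (n + k).+1 - f (n + k)%N) + (f (n + k)%N - f n).
    by rewrite addrA subrK.
  have := rnormD dot hdot (f (n + k).+1 - f (n + k)%N) (f (n + k)%N - f n).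
  have := hf (n + k)%N; have := dS (n + k)%N; lra.
have xtail := tail x (fun n => let: And5 _ h _ _ _ := relp n in h).
have utail := tail u (fun n => let: And5 _ _ h _ _ := relp n in h).
have dh n : d n <= n.+1%:R^-1.
  elim: n => [|n IH]; first by rewrite invr1.
  apply: le_trans (dS n) _; apply: (@le_trans _ _ (n.+1%:R^-1 / 2)).
    by rewrite ler_pM2r.
  by rewrite -invfM lef_pV2 ?posrE // -natrM ler_nat muln2 doubleS !ltnS -addnn leq_addr.
have [X xX] : exists X : V, x n @[n --> \oo] --> X.
  apply: (cvg_of_cauchy dot hdot) => e e0.
  have /cvgr0Pnorm_lt/(_ (Num.min 1 (e / 16))) := @cvg_harmonic R.
  have m0 : 0 < Num.min 1 (e / 16) :> R by rewrite lt_min ltr01 divr_gt0.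
  move=> /(_ m0) [N _ /(_ N (leqnn N))] /=.
  rewrite ger0_norm // lt_min => /andP[N1 N2].
  exists N => n m Nn Nm.
  have := xtail N (n - N)%N; have := xtail N (m - N)%N; rewrite !subnKC //.
  have := d0 n; have := d0 m; have := dh N => h1 h2 h3 h4 h5.
  have h6 : nrm (x n - x m) <= 4 * d N.
    have -> : x n - x m = (x n - x N) + - (x m - x N) by rewrite opprB addrA subrK.
    by have := rnormD dot hdot (x n - x N) (- (x m - x N)); rewrite rnormN; lra.
  rewrite -sqr_rnorm //.
  apply: (@le_trans _ _ ((4 * d N) ^+ 2)).
    by rewrite ler_pXn2r ?nnegrE ?rnorm_ge0 // mulr_ge0 // ltW.
  have := d0 N => h7.
  move: N1 N2 h1; move: (N.+1%:R^-1) => iN N1 N2 h1.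
  have : d N * d N <= d N * 1 by rewrite ler_pM2l //; lra.
  rewrite exprMn expr2; lra.
have [W XW] : dom S X.
  apply: TS; apply: (T_closed x u X 2) => // [n|n].
    by have [] := gp n; rewrite [(p n).1]surjective_pairing.
  have := utail 0%N n; rewrite add0n {2}/u /= subr0 /d /=; have := d0 n; rewrite /d; lra.
have bound n : n.+1%:R <= nrm W + 1.
  have [_ _ _ _ [z [s [zs z1 big sd]]]] := relp n.
  rewrite -/(x n.+1) -/(d n.+1) in big sd.
  have [k hk] : exists k, nrm (x (n.+1 + k)%N - X) <= d n.+1.
    have /cvg_rnorm := xX; move=> /(_ dot hdot)/cvgr0Pnorm_lt/(_ _ (d0 n.+1))[K _ hK].
    exists K; have := hK (n.+1 + K)%N (leq_addl _ _).
    by rewrite /= ger0_norm ?rnorm_ge0 // => /ltW.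
  have h1 : nrm (x n.+1 - X) <= 3 * d n.+1.
    have -> : x n.+1 - X = (x (n.+1 + k)%N - X) + - (x (n.+1 + k)%N - x n.+1).
      by rewrite opprB [RHS]addrC addrA subrK.
    have := rnormD dot hdot (x (n.+1 + k)%N - X) (- (x (n.+1 + k)%N - x n.+1)).
    rewrite rnormN; have := xtail n.+1 k; have := d0 (n.+1 + k)%N; lra.
  have h2 := rip_le_rnorm dot hdot (x n.+1 - X) s.
  have h3 : nrm (x n.+1 - X) * nrm s <= 1.
    apply: (@le_trans _ _ (3 * d n.+1 * nrm s)); first by rewrite ler_wpM2r ?rnorm_ge0.
    lra.
  have h4 : `|ip X s| <= nrm W.
    rewrite -(selfadjoint_rip dot S Ssa XW zs); apply: le_trans (rip_le_rnorm dot hdot _ _) _.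
    by rewrite ler_piMr ?rnorm_ge0.
  have := ler_normD (ip (x n.+1 - X) s) (ip X s); rewrite -ripDl subrK; lra.
have := bound (Num.truncn (nrm W + 1)).
by apply/negP; rewrite -ltNge truncnS_gt.
Qed.

Lemma dom_inclusion_bound : exists2 C : R, 0 <= C &
  forall y v w, T (y, v) -> S (y, w) -> sq w <= C * (sq y + sq v).
Proof.
have [//|h] := pselect (exists2 C : R, 0 <= C &
  forall y v w, T (y, v) -> S (y, w) -> sq w <= C * (sq y + sq v)).
exfalso; apply: gliding_hump => C; apply: contrapT => hn; apply: h.
exists (Num.max 0 C); first by rewrite le_max lexx.
move=> y v w yv yw; rewrite leNgt; apply/negP => lt; apply: hn.
exists y, v, w; split=> //; apply: le_lt_trans lt.
by rewrite ler_wpM2r ?addr_ge0 ?nsq_ge0 // le_max lexx orbT.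
Qed.

End ClosedGraph.

(** * Integrals and step functions *)

Section RealIntegrals.
Context {R : realType}.
Variable mu : {measure set (measurableTypeR R) -> \bar R}.
Local Notation intble f := (mu.-integrable setT (EFin \o f)).

Lemma dominated_integrable (f g : R -> R) : measurable_fun setT f ->
  (forall t, `|f t| <= g t) -> intble g -> intble f.
Proof.
move=> mf fg; apply: le_integrable => //; first exact/measurable_EFinP.
by move=> t _ /=; rewrite lee_fin; apply: le_trans (fg t) (ler_norm _).
Qed.

Lemma dominated_Rintegral (f_ : nat -> R -> R) (f g : R -> R) :
  (forall n, measurable_fun setT (f_ n)) ->
  (forall t, f_ n t @[n --> \oo] --> f t) ->
  (forall n t, `|f_ n t| <= g t) -> intble g -> intble f ->
  \int[mu]_t f_ n t @[n --> \oo] --> \int[mu]_t f t.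
Proof.
move=> mf ff fg ig if_.
rewrite /Rintegral.
apply: (@fine_cvg R nat \oo _ (fun n => \int[mu]_t (f_ n t)%:E)%E).
rewrite fineK; last exact: (integrable_fin_num measurableT if_).
apply: (@dominated_cvg _ _ _ mu setT measurableT (fun n t => (f_ n t)%:E)
  (fun t => (f t)%:E) (fun t => (g t)%:E)) => //.
- by move=> n; exact: (proj2 (measurable_EFinP _ _) (mf n)).
- move=> t _; apply: cvg_EFin; [by near=> n|exact: ff].
- by move=> n t _ /=; rewrite lee_fin.
Unshelve. all: by end_near. Qed.

Lemma integrable_Rsum (I : Type) (s : seq I) (f : I -> R -> R) :
  (forall i, intble (f i)) -> intble (fun t => \sum_(i <- s) f i t).
Proof.
move=> h; have := @integrable_sum _ _ _ mu setT measurableT I s xpredT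
  (fun i => EFin \o f i) (fun i _ => h i).
by congr (_.-integrable _ _); apply/funext => t /=; rewrite sumEFin.
Qed.

Lemma Rintegral_sum (I : Type) (s : seq I) (f : I -> R -> R) :
  (forall i, intble (f i)) ->
  \int[mu]_t (\sum_(i <- s) f i t) = \sum_(i <- s) \int[mu]_t f i t.
Proof.
move=> h; elim: s => [|i s IH].
  rewrite big_nil; under eq_Rintegral do rewrite big_nil.
  by rewrite /Rintegral integral0.
rewrite big_cons -IH -RintegralD //; last exact: integrable_Rsum.
by apply: eq_Rintegral => t _; rewrite big_cons.
Qed.

Lemma Rintegral_indic (X : set (measurableTypeR R)) : measurable X ->
  \int[mu]_t \1_X t = fine (mu X).
Proof. by move=> mX; rewrite /Rintegral integral_indic // setIT. Qed.

Lemma integrable_bounded (f : R -> R) (M : R) : (mu setT < +oo)%E ->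
  measurable_fun setT f -> (forall t, `|f t| <= M) -> intble f.
Proof.
move=> fin mf fM; apply: measurable_bounded_integrable => //.
exists M; split; first exact: num_real.
by move=> x Mx t _ /=; exact: le_trans (fM t) (ltW Mx).
Qed.

End RealIntegrals.

Section Steps.
Context {R : realType}.

(** A linear combination of indicators of sets that may overlap: products and
    powers are then computed from X `&` Y alone, both for functions and for
    projections. *)
Record step := Step {
  step_size : nat;
  step_coef : 'I_step_size -> R;
  step_set : 'I_step_size -> set (measurableTypeR R);
  step_measurable : forall i, measurable (step_set i)
}.

Definition step_val (s : step) (t : R) : R :=
  \sum_(i < step_size s) step_coef s i * \1_(step_set s i) t.

Lemma measurable_step_val s : measurable_fun setT (step_val s).
Proof.
apply: measurable_sum => i; apply: measurable_funM; first exact: measurable_cst.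
by apply: measurable_indic; exact: step_measurable.
Qed.

Definition step_approximates (f : R -> R) (s : nat -> step) :=
  (forall n t, `|step_val (s n) t| <= `|f t|) /\
  (forall t, step_val (s n) t @[n --> \oo] --> f t).

Import HBSimple HBNNSimple.

Lemma step_of_sfun (g : {sfun (measurableTypeR R) >-> R}) :
  exists s : step, forall t, step_val s t = g t.
Proof.
pose r : seq R := finmap.enum_fset (fset_set (g @` setT)).
have m (i : 'I_(size r)) : measurable (g @^-1` [set r`_i]).
  by apply: measurable_sfunP.
by exists (Step (size r) (fun i => r`_i) _ m) => t; rewrite [RHS]fimfunEord.
Qed.

(** Subtract the dyadic approximations of the negative part from those of the
    positive part; at each point one of the two vanishes, whence the bound. *)
Lemma ex_step_approximates (f : measurableTypeR R -> R) : measurable_fun setT f ->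
  exists s, step_approximates f s.
Proof.
move=> mf.
have mf' : measurable_fun setT (EFin \o f) by exact/measurable_EFinP.
pose fp := nnsfun_approx measurableT (measurable_funepos mf').
pose fn := nnsfun_approx measurableT (measurable_funeneg mf').
have ndp := @nd_nnsfun_approx _ _ _ _ measurableT _ (measurable_funepos mf').
have ndn := @nd_nnsfun_approx _ _ _ _ measurableT _ (measurable_funeneg mf').
have cp t : fp n t @[n --> \oo] --> Num.max (f t) 0.
  have := @cvg_nnsfun_approx _ _ _ _ measurableT _ (measurable_funepos mf')
    (fun x _ => funepos_ge0 _ x) t Logic.I.
  by rewrite funeposE /= -EFin_max => /fine_cvgP[_].
have cn t : fn n t @[n --> \oo] --> Num.max (- f t) 0.
  have := @cvg_nnsfun_approx _ _ _ _ measurableT _ (measurable_funeneg mf')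
    (fun x _ => funeneg_ge0 _ x) t Logic.I.
  by rewrite funenegE /= -EFin_max => /fine_cvgP[_].
have le_cvg (u : nat -> R) l n : {homo u : n m / (n <= m)%N >-> n <= m} ->
    u n @[n --> \oo] --> l -> u n <= l.
  move=> nd c; rewrite -(cvg_lim (@Rhausdorff R) c).
  by apply: nondecreasing_cvgn_le => //; apply/cvg_ex; exists l.
have lp n t : fp n t <= Num.max (f t) 0.
  by apply: (le_cvg (fun n => fp n t)) => // a b ab; exact/lefP/ndp.
have ln n t : fn n t <= Num.max (- f t) 0.
  by apply: (le_cvg (fun n => fn n t)) => // a b ab; exact/lefP/ndn.
pose g n : {sfun (measurableTypeR R) >-> R} := fp n \+ cst (-1) \* fn n.
have gE n t : g n t = fp n t - fn n t by rewrite /g /= mulN1r.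
have [s hs] := choice (fun n => step_of_sfun (g n)).
exists s; split=> [n t|t].
  rewrite hs gE.
  have p0 : 0 <= fp n t by [].
  have n0 : 0 <= fn n t by [].
  have := lp n t; have := ln n t.
  rewrite /Num.max; case: ltP => h1; case: ltP => h2 h3 h4;
    rewrite ler_norml; have [h5|h5] := ger0P (f t); apply/andP; split; lra.
under eq_fun do rewrite hs gE.
have -> : f t = Num.max (f t) 0 - Num.max (- f t) 0.
  by rewrite /Num.max; case: ltP => h1; case: ltP => h2; lra.
exact: cvgB (cp t) (cn t).
Qed.

End Steps.

(** * Step functions of a projection-valued measure *)

Section StepOperators.
Context {R : realType} {V : completeNormedModType R[i]}.
Variable dot : {dot V for Num.conj}.
Hypothesis hdot : norm_of_dot dot.
Local Notation ip := (rip dot).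
Local Notation sq := (nsq dot).
Variable E : proj_measure dot.
Local Notation mu x := (spec_mu E x).
Local Notation intble x f := ((mu x).-integrable setT (EFin \o f)).

Lemma rip_pvm X Y x y : measurable X -> measurable Y ->
  ip (E X x) (E Y y) = ip x (E (X `&` Y) y).
Proof. by move=> mX mY; rewrite /rip pvm_sym // pvmI. Qed.

Lemma rip_pvm_sym X x y : measurable X -> ip (E X x) y = ip x (E X y).
Proof. by move=> mX; rewrite /rip pvm_sym. Qed.

Lemma nsq_pvm X x : measurable X -> sq (E X x) = ip x (E X x).
Proof. by move=> mX; rewrite /nsq rip_pvm // setIid. Qed.

Lemma spec_muE x X : mu x X = (sq (E X x))%:E.
Proof. by rewrite /spec_mu (nsqE dot hdot). Qed.

Lemma spec_mu_fin x : (mu x setT < +oo)%E.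
Proof. by rewrite spec_muE ltry. Qed.

Lemma spec_mu_setT x : mu x setT = (sq x)%:E.
Proof. by rewrite spec_muE pvmT. Qed.

Definition step_op (s : step) (x : V) : V :=
  \sum_(i < step_size s) (step_coef s i)%:C *: E (step_set s i) x.

Lemma step_op_linear s : linear (step_op s).
Proof.
move=> a x y; rewrite /step_op scaler_sumr -big_split; apply: eq_bigr => i _ /=.
by rewrite linearP /= scalerDr !scalerA mulrC.
Qed.

Lemma step_opD s x y : step_op s (x + y) = step_op s x + step_op s y.
Proof. by have := step_op_linear s 1 x y; rewrite !scale1r. Qed.

Lemma step_opZ s a x : step_op s (a *: x) = a *: step_op s x.
Proof.
rewrite /step_op scaler_sumr; apply: eq_bigr => i _ /=.
by rewrite linearZ /= !scalerA mulrC.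
Qed.

Lemma step_opB s x y : step_op s (x - y) = step_op s x - step_op s y.
Proof. by rewrite step_opD -scaleN1r step_opZ scaleN1r. Qed.

Lemma rip_suml (I : Type) (r : seq I) (v : I -> V) y :
  ip (\sum_(i <- r) v i) y = \sum_(i <- r) ip (v i) y.
Proof. by apply: (big_morph (ip^~ y)) => [a b|]; [exact: ripDl|exact: rip0l]. Qed.

Lemma rip_sumr (I : Type) (r : seq I) (v : I -> V) y :
  ip y (\sum_(i <- r) v i) = \sum_(i <- r) ip y (v i).
Proof. by rewrite ripC rip_suml; apply: eq_bigr => i _; rewrite ripC. Qed.

Lemma step_op_sym s x y : ip (step_op s x) y = ip x (step_op s y).
Proof.
rewrite /step_op rip_suml rip_sumr; apply: eq_bigr => i _.
by rewrite ripZl ripZr rip_pvm_sym //; exact: step_measurable.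
Qed.

Lemma step_op_pvm s X x : measurable X -> step_op s (E X x) = E X (step_op s x).
Proof.
move=> mX; rewrite /step_op linear_sum; apply: eq_bigr => i _.
have mi := step_measurable s i.
by rewrite linearZ /= -pvmI // -pvmI // setIC.
Qed.

Lemma step_val_bounded (s : @step R) : exists M : R, forall t, `|step_val s t| <= M.
Proof.
exists (\sum_(i < step_size s) `|step_coef s i|) => t.
apply: le_trans (ler_norm_sum _ _ _) _; apply: ler_sum => i _.
by rewrite normrM ler_piMr // indicE; case: (_ \in _); rewrite ?normr1 ?normr0.
Qed.

Lemma step_val_integrable x s s' (Y : set (measurableTypeR R)) : measurable Y ->
  intble x (fun t => step_val s t * (step_val s' t * \1_Y t)).
Proof.
move=> mY; have [M hM] := step_val_bounded s; have [M' hM'] := step_val_bounded s'.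
apply: (@integrable_bounded _ _ _ (M * M')) => [| |t]; first exact: spec_mu_fin.
  apply: measurable_funM; first exact: measurable_step_val.
  apply: measurable_funM; first exact: measurable_step_val.
  exact: measurable_indic.
rewrite !normrM; apply: ler_pM => //.
apply: le_trans (hM' t).
by rewrite ler_piMr // indicE; case: (_ \in _); rewrite ?normr1 ?normr0.
Qed.

(** E(X) E(Y) E(X') = E(X `&` Y `&` X') corresponds to the product of the
    indicators; the middle set Y localizes the identity. *)
Lemma rip_step_op3 x s s' (Y : set (measurableTypeR R)) : measurable Y ->
  ip (step_op s x) (E Y (step_op s' x)) =
  \int[mu x]_t (step_val s t * (step_val s' t * \1_Y t)).
Proof.
move=> mY.
have ii (c d : R) (X : set (measurableTypeR R)) : measurable X ->
    intble x (fun t => c * (d * \1_X t)).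
  move=> mX; apply: (@integrable_bounded _ _ _ (`|c| * `|d|)) => [| |t].
  - exact: spec_mu_fin.
  - apply: measurable_funM; first exact: measurable_cst.
    by apply: measurable_funM; [exact: measurable_cst|exact: measurable_indic].
  - rewrite !normrM ler_wpM2l // ler_piMr // indicE.
    by case: (_ \in _); rewrite ?normr1 ?normr0.
have m i j : measurable (step_set s i `&` (Y `&` step_set s' j)).
  apply: measurableI; first exact: step_measurable.
  by apply: measurableI => //; exact: step_measurable.
transitivity (\int[mu x]_t (\sum_(i < step_size s) \sum_(j < step_size s')
    step_coef s i * (step_coef s' j * \1_(step_set s i `&` (Y `&` step_set s' j)) t))).
  rewrite Rintegral_sum; last by move=> i; apply: integrable_Rsum => j; exact: ii.
  rewrite /step_op rip_suml; apply: eq_bigr => i _.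
  rewrite Rintegral_sum; last by move=> j; exact: ii.
  rewrite linear_sum rip_sumr; apply: eq_bigr => j _.
  have mi := step_measurable s i; have mj := step_measurable s' j.
  rewrite ripZl linearZ /= ripZr -pvmI // rip_pvm //; last exact: measurableI.
  rewrite -nsq_pvm //.
  have i1 : intble x (fun t => step_coef s' j *
      \1_(step_set s i `&` (Y `&` step_set s' j)) t).
    have := ii 1 (step_coef s' j) _ (m i j).
    by congr (_.-integrable _ _); apply/funext => t /=; rewrite mul1r.
  have i0 : intble x (\1_(step_set s i `&` (Y `&` step_set s' j)) : R -> R).
    have := ii 1 1 _ (m i j).
    by congr (_.-integrable _ _); apply/funext => t /=; rewrite !mul1r.
  rewrite RintegralZl // RintegralZl // Rintegral_indic //.
  by congr (_ * (_ * _)); exact: (congr1 fine (esym (spec_muE _ _))).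
apply: eq_Rintegral => t _.
rewrite /step_val mulr_suml; apply: eq_bigr => i _.
rewrite mulr_suml mulr_sumr; apply: eq_bigr => j _.
by rewrite !indicI /=; ring.
Qed.

Lemma rip_step_op2 x s s' :
  ip (step_op s x) (step_op s' x) = \int[mu x]_t (step_val s t * step_val s' t).
Proof.
have := rip_step_op3 x s s' setT measurableT; rewrite pvmT => ->.
by apply: eq_Rintegral => t _; rewrite indicT mulr1.
Qed.

Lemma step_val2_integrable x s s' : intble x (fun t => step_val s t * step_val s' t).
Proof.
have := step_val_integrable x s s' setT measurableT.
by congr (_.-integrable _ _); apply/funext => t /=; rewrite indicT mulr1.
Qed.

Definition step_one : @step R := Step 1 (fun=> 1) (fun=> setT) (fun=> measurableT).

Lemma step_val_one t : step_val step_one t = 1.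
Proof. by rewrite /step_val big_ord_recl big_ord0 /= indicT addr0 mul1r. Qed.

Lemma step_op_one x : step_op step_one x = x.
Proof. by rewrite /step_op big_ord_recl big_ord0 /= pvmT addr0 scale1r. Qed.

Lemma rip_step_op x s : ip (step_op s x) x = \int[mu x]_t (step_val s t).
Proof.
rewrite -{2}(step_op_one x) rip_step_op2.
by apply: eq_Rintegral => t _; rewrite step_val_one mulr1.
Qed.

Lemma nsq_step_op x s : sq (step_op s x) = \int[mu x]_t (step_val s t ^+ 2).
Proof. by rewrite /nsq rip_step_op2; apply: eq_Rintegral => t _; rewrite expr2. Qed.

Lemma nsq_step_opB x s s' : sq (step_op s x - step_op s' x) =
  \int[mu x]_t ((step_val s t - step_val s' t) ^+ 2).
Proof.
rewrite nsqB !nsq_step_op rip_step_op2.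
have i1 := step_val2_integrable x s s; have i2 := step_val2_integrable x s s'.
have i3 := step_val2_integrable x s' s'.
have i4 : intble x (fun t => 2 * (step_val s t * step_val s' t)).
  by have := @integrableZl _ _ _ (mu x) setT measurableT 2 _ i2.
rewrite -RintegralZl //.
have e u : (fun t => step_val u t ^+ 2) = (fun t => step_val u t * step_val u t).
  by apply/funext => t; rewrite expr2.
rewrite !e -RintegralB // -RintegralD //.
  by apply: eq_Rintegral => t _; ring.
have := @integrableB _ _ _ (mu x) setT measurableT _ _ i1 i4.
by congr (_.-integrable _ _).
Qed.

End StepOperators.

(** * The functional calculus as a limit of step functions *)

Section FunctionalCalculusLimits.
Context {R : realType} {V : completeNormedModType R[i]}.
Variable dot : {dot V for Num.conj}.
Hypothesis hdot : norm_of_dot dot.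
Local Notation ip := (rip dot).
Local Notation sq := (nsq dot).
Variable E : proj_measure dot.
Local Notation mu x := (spec_mu E x).
Local Notation intble x f := ((mu x).-integrable setT (EFin \o f)).
Variables (f : measurableTypeR R -> R) (s : nat -> @step R).
Hypothesis mf : measurable_fun setT f.
Hypothesis sf : step_approximates f s.
Local Notation F n := (step_op dot E (s n)).
Local Notation D := (fcalc_dom E f).

Let sb n t : `|step_val (s n) t| <= `|f t|. Proof. by case: sf. Qed.
Let sc t : step_val (s n) t @[n --> \oo] --> f t. Proof. by case: sf. Qed.

Let sb2 n t : step_val (s n) t ^+ 2 <= f t ^+ 2.
Proof.
rewrite -real_normK ?num_real // -[leRHS]real_normK ?num_real //.
by rewrite ler_pXn2r ?nnegrE.
Qed.

Let mf2 : measurable_fun setT (fun t => f t ^+ 2).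
Proof. exact: measurable_funX. Qed.

Let ms n : measurable_fun setT (step_val (s n)).
Proof. exact: measurable_step_val. Qed.

Let ms2 n : measurable_fun setT (fun t => step_val (s n) t ^+ 2).
Proof. exact: measurable_funX. Qed.

Lemma fcalc_dom_sq_integrable x : D x -> intble x (fun t => f t ^+ 2).
Proof.
move=> Dx; apply/integrableP; split; first exact/measurable_EFinP.
under eq_integral do rewrite /= ger0_norm ?sqr_ge0 //.
exact: Dx.
Qed.

Lemma fcalc_dom_integrable x : D x -> intble x f.
Proof.
move=> Dx; apply: (@dominated_integrable _ _ _ (fun t => 1 + f t ^+ 2)) => //.
  move=> t; have := sqr_ge0 (`|f t| - 1); rewrite -[f t ^+ 2]real_normK ?num_real //.
  have := normr_ge0 (f t); nra.
have i1 : intble x (fun=> 1).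
  apply: (@integrable_bounded _ _ _ 1) => //; first exact: spec_mu_fin.
  by move=> t; rewrite normr1.
have := @integrableD _ _ _ (mu x) setT measurableT _ _ i1 (fcalc_dom_sq_integrable x Dx).
by congr (_.-integrable _ _).
Qed.

Lemma nsq_step_le x n : D x -> sq (F n x) <= \int[mu x]_t (f t ^+ 2).
Proof.
move=> Dx; rewrite nsq_step_op //; apply: le_Rintegral => //.
- apply: (@dominated_integrable _ _ _ (fun t => f t ^+ 2)) => //.
    by move=> t; rewrite ger0_norm ?sqr_ge0.
  exact: fcalc_dom_sq_integrable.
- exact: fcalc_dom_sq_integrable.
Qed.

Lemma cvg_rip_step x : D x ->
  ip (F n x) x @[n --> \oo] --> \int[mu x]_t f t.
Proof.
move=> Dx; under eq_fun do rewrite (rip_step_op dot hdot).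
have i := fcalc_dom_integrable x Dx.
apply: (@dominated_Rintegral _ _ _ _ (fun t => `|f t|)) => //.
exact: (integrable_norm i).
Qed.

Lemma cvg_nsq_step x : D x ->
  sq (F n x) @[n --> \oo] --> \int[mu x]_t (f t ^+ 2).
Proof.
move=> Dx; under eq_fun do rewrite (nsq_step_op dot hdot).
have i := fcalc_dom_sq_integrable x Dx.
apply: (@dominated_Rintegral _ _ _ _ (fun t => f t ^+ 2)) => //.
- by move=> t; under eq_fun do rewrite expr2; rewrite expr2; apply: cvgM.
- by move=> n t; rewrite ger0_norm ?sqr_ge0.
Qed.

(** Fatou's lemma for the squares of the approximating step functions. *)
Lemma fcalc_dom_of_bounded x (C : R) : (forall n, sq (F n x) <= C) ->
  D x /\ \int[mu x]_t (f t ^+ 2) <= C.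
Proof.
move=> h.
have c2 t : (step_val (s n) t ^+ 2)%:E @[n --> \oo] --> (f t ^+ 2)%:E.
  apply: cvg_EFin; first by near=> n.
  under eq_fun do rewrite /= expr2; rewrite expr2; exact: cvgM.
have le : (\int[mu x]_t ((f t) ^+ 2)%:E <= C%:E)%E.
  have m1 n : measurable_fun setT (fun t => (step_val (s n) t ^+ 2)%:E).
    by apply/measurable_EFinP.
  have p1 n t : setT t -> (0 <= (step_val (s n) t ^+ 2)%:E)%E by rewrite lee_fin sqr_ge0.
  have -> : (\int[mu x]_t ((f t) ^+ 2)%:E =
      \int[mu x]_t (limn_einf (fun n => (step_val (s n) t ^+ 2)%:E)))%E.
    by apply: eq_integral => t _; rewrite (cvg_limn_einf_sup (c2 t)).
  apply: le_trans (fatou (mu x) measurableT m1 p1) _.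
  have hC n : (\int[mu x]_t (step_val (s n) t ^+ 2)%:E <= C%:E)%E.
    have := h n; rewrite nsq_step_op // /Rintegral -lee_fin fineK //.
    apply: integrable_fin_num => //.
    have := step_val2_integrable dot hdot E x (s n) (s n).
    by congr (_.-integrable _ _); apply/funext => t /=; rewrite expr2.
  rewrite limn_einf_lim; apply: lime_le; first exact: is_cvg_einfs.
  apply: nearW => n; apply: le_trans (hC n).
  by apply: ereal_inf_lbound; exists n => //=.
have Dx : D x by apply: le_lt_trans le _; rewrite ltry.
split=> //; rewrite /Rintegral -lee_fin fineK //.
exact: integrable_fin_num (fcalc_dom_sq_integrable x Dx).
Unshelve. all: by end_near. Qed.

(** |F_n x - F_m x|^2 is the integral of the square of the difference of two step
    functions, both of which tend to f in L^2 by dominated convergence. *)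
Lemma step_op_cvg x : D x -> exists u : V, F n x @[n --> \oo] --> u.
Proof.
move=> Dx; apply: (cvg_of_cauchy dot hdot) => e e0.
have ar (a b : R) : a < e / 4 -> b < e / 4 -> 2 * a + 2 * b <= e by lra.
pose g n t := (step_val (s n) t - f t) ^+ 2.
have i := fcalc_dom_sq_integrable x Dx.
have i4 : intble x (fun t => 4 * f t ^+ 2).
  by have := @integrableZl _ _ _ (mu x) setT measurableT 4 _ i.
have g0 n t : 0 <= g n t by exact: sqr_ge0.
have gb n t : `|g n t| <= 4 * f t ^+ 2.
  rewrite ger0_norm //; have := sb2 n t; have := sqr_ge0 (step_val (s n) t + f t).
  rewrite /g; nra.
have mg n : measurable_fun setT (g n).
  by apply: measurable_funX; apply: measurable_funB.
have ig n : intble x (g n) by apply: dominated_integrable i4.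
have : \int[mu x]_t g n t @[n --> \oo] --> \int[mu x]_t (cst 0 t).
  apply: (@dominated_Rintegral _ _ _ _ (fun t => 4 * f t ^+ 2)) => //.
    move=> t; have a : step_val (s n) t - f t @[n --> \oo] --> (0 : R).
      by apply/subr_cvg0.
    rewrite /g /cst -[X in _ --> X](mulr0 0); under eq_fun do rewrite expr2.
    exact: (cvgM a a).
  apply: (@dominated_integrable _ _ _ (fun t => 4 * f t ^+ 2)) => // t.
  by rewrite normr0 mulr_ge0 // sqr_ge0.
rewrite [X in _ --> X](_ : _ = 0); last by rewrite /Rintegral integral0.
move=> /cvgr0Pnorm_lt/(_ (e / 4))[|N _ hN]; first by rewrite divr_gt0.
exists N => n m Nn Nm.
have := hN n Nn; have := hN m Nm => /=.
rewrite !ger0_norm ?Rintegral_ge0 // => hm hn.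
rewrite nsq_step_opB //.
apply: (@le_trans _ _ (\int[mu x]_t (2 * g n t + 2 * g m t))).
  have i2 k : intble x (fun t => 2 * g k t).
    by have := @integrableZl _ _ _ (mu x) setT measurableT 2 _ (ig k).
  apply: le_Rintegral => //.
  - apply: (@dominated_integrable _ _ _ (fun t => 4 * f t ^+ 2)) => //.
      by apply: measurable_funX; apply: measurable_funB.
    move=> t; rewrite ger0_norm ?sqr_ge0 //.
    have := sb2 n t; have := sb2 m t; have := sqr_ge0 (step_val (s n) t + step_val (s m) t).
    nra.
  - have := @integrableD _ _ _ (mu x) setT measurableT _ _ (i2 n) (i2 m).
    by congr (_.-integrable _ _).
  - move=> t _; have := sqr_ge0 (step_val (s n) t + step_val (s m) t - 2 * f t).
    rewrite /g; nra.
have i2 k : intble x (fun t => 2 * g k t).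
  by have := @integrableZl _ _ _ (mu x) setT measurableT 2 _ (ig k).
by rewrite RintegralD // !RintegralZl //; exact: ar.
Qed.

Lemma fcalc_domD x z : D x -> D z -> D (x + z).
Proof.
move=> Dx Dz.
have [|//] := fcalc_dom_of_bounded (x + z)
  (2 * \int[mu x]_t (f t ^+ 2) + 2 * \int[mu z]_t (f t ^+ 2)).
move=> n; rewrite step_opD.
have := nsq_step_le x n Dx; have := nsq_step_le z n Dz.
have := nsq_ge0 dot hdot (F n x - F n z); rewrite nsqB nsqD; lra.
Qed.

Lemma nsq_iM x : sq ('i%C *: x) = sq x.
Proof.
rewrite /nsq rip_iMl linearZr_LR /=.
have := hdot x; have := nsqE dot hdot x => -> <- /=.
by rewrite !(mul0r, mulr0, mulN1r, sub0r, addr0, add0r, opprK, mulNr, mul1r).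
Qed.

Lemma fcalc_domZi x : D x -> D ('i%C *: x).
Proof.
move=> Dx; have [|//] := fcalc_dom_of_bounded ('i%C *: x) (\int[mu x]_t (f t ^+ 2)).
by move=> n; rewrite step_opZ nsq_iM; exact: nsq_step_le.
Qed.

Lemma fcalc_domN x : D x -> D (- x).
Proof.
move=> Dx; have [|//] := fcalc_dom_of_bounded (- x) (\int[mu x]_t (f t ^+ 2)).
by move=> n; rewrite -scaleN1r step_opZ scaleN1r nsqN; exact: nsq_step_le.
Qed.

(** For step functions the right-hand side is the polarization identity for the
    symmetric operator F_n. *)
Lemma rip_step_limit x z u : D x -> D z -> F n x @[n --> \oo] --> u ->
  ip u z = 4^-1 * (\int[mu (x + z)]_t f t - \int[mu (x - z)]_t f t).
Proof.
move=> Dx Dz xu; have c1 := cvg_rip dot hdot _ _ z xu.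
have c2 := cvg_rip_step _ (fcalc_domD _ _ Dx Dz).
have c3 := cvg_rip_step _ (fcalc_domD _ _ Dx (fcalc_domN _ Dz)).
have c4 : 4^-1 * (ip (F n (x + z)) (x + z) - ip (F n (x - z)) (x - z)) @[n --> \oo] -->
    4^-1 * (\int[mu (x + z)]_t f t - \int[mu (x - z)]_t f t).
  by apply: cvgMr; exact: cvgB.
apply: (cvg_unique (@Rhausdorff R) c1); apply: cvg_trans c4.
suff -> : (fun n => 4^-1 * (ip (F n (x + z)) (x + z) - ip (F n (x - z)) (x - z))) =
    (fun n => ip (F n x) z) by [].
apply/funext => n; rewrite step_opD step_opB !(ripDl, ripDr, ripNl, ripNr).
by rewrite (step_op_sym dot E (s n) z x) (ripC dot z (F n x)); field.
Qed.

Lemma spec_integralE x z : D x -> D z ->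
  complex.Re (spec_integral E f x z) =
    4^-1 * (\int[mu (x + z)]_t f t - \int[mu (x - z)]_t f t) /\
  complex.Im (spec_integral E f x z) =
    4^-1 * (\int[mu (x + 'i%C *: z)]_t f t - \int[mu (x - 'i%C *: z)]_t f t).
Proof.
move=> Dx Dz; rewrite /spec_integral.
have -> : 4^-1 = (4^-1)%:C :> R[i] by rewrite fmorphV rmorph_nat.
have e3 : ('i%C : R[i]) ^+ 3 = - 'i%C by rewrite exprS sqr_i mulrN1.
have sum4 (G : nat -> R[i]) : \sum_(k < 4) G k = G 0%N + G 1%N + G 2%N + G 3%N.
  by rewrite !big_ord_recr big_ord0 /= add0r.
rewrite (sum4 (fun k => 'i%C ^+ k * (\int[mu (x + 'i%C ^+ k *: z)]_t f t)%:C)).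
rewrite expr0 expr1 sqr_i e3 !scale1r scaleN1r scaleNr.
move: (\int[_]_t _) (\int[_]_t _) (\int[_]_t _) (\int[_]_t _) => a b c d.
rewrite /=.
rewrite !(mul0r, mulr0, mulN1r, sub0r, subr0, addr0, add0r, opprK, mulNr, mul1r, oppr0).
by split; ring.
Qed.

Definition sublevel n : set (measurableTypeR R) := [set t | `|f t| <= n%:R].

Lemma measurable_sublevel n : measurable (sublevel n).
Proof.
rewrite -[sublevel n]setTI; apply: measurable_fun_le => //.
exact: measurableT_comp.
Qed.

Lemma fcalc_dom_sublevel n x : D (E (sublevel n) x).
Proof.
have mX := measurable_sublevel n.
have [|//] := fcalc_dom_of_bounded (E (sublevel n) x) (n%:R ^+ 2 * sq x).
move=> k; rewrite step_op_pvm // nsq_pvm //.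
rewrite rip_step_op3 //.
have b t : step_val (s k) t * (step_val (s k) t * \1_(sublevel n) t) <= n%:R ^+ 2.
  rewrite indicE; case: (boolP (t \in sublevel n)) => [|_]; last by rewrite !mulr0 sqr_ge0.
  rewrite inE /sublevel /= mulr1 -expr2 => ft; apply: le_trans (sb2 k t) _.
  by rewrite -real_normK ?num_real // ler_pXn2r ?nnegrE.
have ic : intble x (fun=> (n%:R ^+ 2 : R)).
  apply: (@integrable_bounded _ _ _ (`|n%:R ^+ 2|)) => //; exact: spec_mu_fin.
apply: (@le_trans _ _ (\int[mu x]_t (n%:R ^+ 2))).
  by apply: le_Rintegral => //; exact: step_val_integrable.
by rewrite Rintegral_cst // -[fine _]/(fine (spec_mu E x setT)) spec_mu_setT.
Qed.

(** |x - E(X) x|^2 = |x|^2 - mu(X) and the sets |f| <= n exhaust the line. *)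
Lemma pvm_sublevel_cvg u : E (sublevel n) u @[n --> \oo] --> u.
Proof.
have mX := measurable_sublevel.
apply/(cvg_nsq dot hdot).
have i1 : intble u (fun=> 1).
  apply: (@integrable_bounded _ _ _ 1) => //; first exact: spec_mu_fin.
  by move=> t; rewrite normr1.
have c : \int[mu u]_t \1_(sublevel n) t @[n --> \oo] --> \int[mu u]_t (cst 1 t).
  apply: (@dominated_Rintegral _ _ _ _ (fun=> 1)) => //.
  - by move=> n; apply: (measurable_indic (mX n)).
  - move=> t; apply: cvg_near_cst.
    exists (Num.truncn `|f t|).+1 => // n /= le; rewrite indicE mem_set //.
    rewrite /sublevel /=; apply: le_trans (ltW (truncnS_gt _)) _.
    by rewrite ler_nat.
  - by move=> n t; rewrite indicE; case: (_ \in _); rewrite ?normr1 ?normr0.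
have e n : sq (E (sublevel n) u - u) = sq u - \int[mu u]_t \1_(sublevel n) t.
  rewrite Rintegral_indic // -[fine _]/(fine (spec_mu E u (sublevel n))) spec_muE //=.
  by rewrite nsqB rip_pvm_sym // -nsq_pvm //; ring.
under eq_fun do rewrite e.
rewrite -(subrr (sq u)); apply: cvgB; first exact: cvg_cst.
move: c; rewrite Rintegral_cst // mul1r -[fine _]/(fine (spec_mu E u setT)).
by rewrite spec_mu_setT.
Qed.

Lemma dense_fcalc_dom u : (forall z, D z -> ip u z = 0) -> u = 0.
Proof.
move=> h; apply: (nsq_eq0 dot hdot).
have c := cvg_ripr dot hdot _ _ u (pvm_sublevel_cvg u).
apply: (cvg_unique (@Rhausdorff R) c).
rewrite (_ : (fun n => _) = fun=> 0); first exact: cvg_cst.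
by apply/funext => n; exact: h (fcalc_dom_sublevel n u).
Qed.

(** The vector u with <u, z> = \int f d<E x, z> is the limit of F_n x.  It is the
    only one, because the vectors E(|f| <= n) z are in the domain of f(B) and
    converge to z. *)
Lemma fcalcP x u : fcalc E f (x, u) <-> F n x @[n --> \oo] --> u.
Proof.
split=> [[/= Dx h]|xu].
  have [v xv] := step_op_cvg x Dx.
  suff e : u - v = 0 by rewrite (subr0_eq e).
  apply: dense_fcalc_dom => z Dz; rewrite ripBl (rip_step_limit x z v) //.
  by rewrite /rip h // (proj1 (spec_integralE x z Dx Dz)) subrr.
have Dx : D x.
  have c : sq (F n x) @[n --> \oo] --> sq u by exact: cvg_rip2.
  have [M [_ hM]] := cvg_seq_bounded (cvgP _ c).
  have [|//] := fcalc_dom_of_bounded x (M + 1).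
  move=> n; apply: le_trans (ler_norm _) _.
  by apply: (hM (M + 1)) => //; rewrite ltrDl.
split=> //= z Dz; have [e1 e2] := spec_integralE x z Dx Dz.
have := rip_step_limit x z u Dx Dz xu.
have := rip_step_limit x _ u Dx (fcalc_domZi z Dz) xu.
rewrite rip_iMr -e1 -e2 /rip.
by case: (dot u z) (spec_integral _ _ _ _) => a b [c d] /= -> ->.
Qed.

Lemma dom_fcalc x : D x -> dom (fcalc E f) x.
Proof. by move=> /step_op_cvg[u xu]; exists u; apply/fcalcP. Qed.

Lemma nsq_fcalc x u : fcalc E f (x, u) -> sq u = \int[mu x]_t (f t ^+ 2).
Proof.
move=> h; have [Dx _] := h; move: h => /fcalcP xu.
apply: (cvg_unique (@Rhausdorff R) _ (cvg_nsq_step x Dx)).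
exact: cvg_rip2.
Qed.

Lemma fcalc_op : is_operator (fcalc E f).
Proof.
split.
- apply/fcalcP; rewrite (_ : (fun n => F n 0) = fun=> 0); first exact: cvg_cst.
  by apply/funext => n; have := step_opB dot E (s n) 0 0; rewrite !subrr.
- move=> a x y u v /fcalcP xu /fcalcP yv; apply/fcalcP.
  under eq_fun do rewrite step_op_linear.
  by apply: cvgD => //; exact: cvgZr.
- move=> x u v /fcalcP xu /fcalcP xv.
  exact: (cvg_unique (@norm_hausdorff _ V) xu xv).
Qed.

(** |F_n l|^2 is the limit of <F_n x_k, F_n l>, where |F_n x_k| <= |u_k| <= C; so
    F_n l is bounded by C and [fcalc_dom_of_bounded] applies. *)
Lemma fcalc_closed (x u : nat -> V) (l : V) (C : R) :
  (forall n, fcalc E f (x n, u n)) -> (forall n, rnorm dot (u n) <= C) ->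
  x n @[n --> \oo] --> l -> dom (fcalc E f) l.
Proof.
move=> xu uC xl; apply: dom_fcalc.
have [|//] := fcalc_dom_of_bounded l (C ^+ 2).
move=> n.
have C0 : 0 <= C by apply: le_trans (uC 0%N); exact: rnorm_ge0.
have bd k : ip (F n (x k)) (F n l) <= C * rnorm dot (F n l).
  apply: le_trans (ler_norm _) (le_trans (rip_le_rnorm dot hdot _ _) _).
  apply: ler_wpM2r; first exact: rnorm_ge0.
  apply: le_trans (uC k); rewrite /rnorm ler_wsqrtr //.
  by rewrite (nsq_fcalc _ _ (xu k)); apply: nsq_step_le; case: (xu k).
have c : ip (F n (x k)) (F n l) @[k --> \oo] --> sq (F n l).
  rewrite /nsq step_op_sym; under eq_fun do rewrite step_op_sym.
  exact: cvg_rip.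
have le : sq (F n l) <= C * rnorm dot (F n l).
  rewrite -(cvg_lim (@Rhausdorff R) c); apply: limr_le; first exact: cvgP c.
  by apply: nearW => k; exact: bd.
have r0 := rnorm_ge0 dot (F n l).
rewrite -sqr_rnorm // ler_pXn2r ?nnegrE //.
have [->//|rn0] := eqVneq (rnorm dot (F n l)) 0.
have rp : 0 < rnorm dot (F n l) by rewrite lt_neqAle eq_sym rn0.
by rewrite -(ler_pM2r rp) -expr2 sqr_rnorm.
Qed.

Lemma bounded_pvm X : measurable X -> bounded_op (E X).
Proof.
move=> mX; exists 1 => x; rewrite mul1r !(rnormE dot hdot) lecR /rnorm.
apply: ler_wsqrtr; have := nsq_ge0 dot hdot (x - E X x).
by rewrite nsqB -nsq_pvm //; lra.
Qed.

Lemma fcalc_pvm X x u : measurable X ->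
  fcalc E f (x, u) -> fcalc E f (E X x, E X u).
Proof.
move=> mX /fcalcP xu; apply/fcalcP; under eq_fun do rewrite step_op_pvm //.
by apply: (cvg_bounded_op dot hdot) => //; exact: bounded_pvm.
Qed.

(** For f_n in place of f this is [rip_step_op3]; the squares f_n^2 are dominated
    by f^2, which is integrable for the measure of x. *)
Lemma rip_fcalc_pvm (Y : set (measurableTypeR R)) x u : measurable Y -> fcalc E f (x, u) ->
  ip u (E Y u) = \int[mu x]_t (f t ^+ 2 * \1_Y t).
Proof.
move=> mY h; have [Dx _] := h; move: h => /fcalcP xu.
have c1 := cvg_rip2 dot hdot _ _ _ _ xu
  (cvg_bounded_op dot hdot (E Y) _ _ (bounded_pvm Y mY) xu).
apply: (cvg_unique (@Rhausdorff R) c1).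
rewrite (_ : (fun n => _) =
    fun n => \int[mu x]_t (step_val (s n) t * (step_val (s n) t * \1_Y t))); last first.
  by apply/funext => n; exact: rip_step_op3.
have i := fcalc_dom_sq_integrable x Dx.
have b n t : `|step_val (s n) t * (step_val (s n) t * \1_Y t)| <= f t ^+ 2.
  rewrite mulrA -expr2 normrM (@ger0_norm _ (_ ^+ 2)) ?sqr_ge0 //.
  apply: le_trans (sb2 n t); rewrite ler_piMr ?sqr_ge0 // indicE.
  by case: (_ \in _); rewrite ?normr1 ?normr0.
apply: (@dominated_Rintegral _ _ _ _ (fun t => f t ^+ 2)) => //.
- by move=> n; apply: measurable_funM => //; apply: measurable_funM.
- move=> t; rewrite expr2 -mulrA; apply: cvgM => //.
  exact: cvgMl.
- apply: (@dominated_integrable _ _ _ (fun t => f t ^+ 2)) => //.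
    by apply: measurable_funM => //; apply: (measurable_indic mY).
  move=> t; rewrite normrM (@ger0_norm _ (_ ^+ 2)) ?sqr_ge0 //.
  rewrite ler_piMr ?sqr_ge0 // indicE.
  by case: (_ \in _); rewrite ?normr1 ?normr0.
Qed.

Lemma rip_fcalc x u : fcalc E f (x, u) -> ip u x = \int[mu x]_t f t.
Proof.
move=> h; have [Dx _] := h; move: h => /fcalcP xu.
exact: (cvg_unique (@Rhausdorff R) (cvg_rip dot hdot _ _ x xu) (cvg_rip_step x Dx)).
Qed.

End FunctionalCalculusLimits.

(** * The representation by the square root and the sign *)

Section SecondRepresentation.
Context {R : realType} {V : completeNormedModType R[i]}.
Variable dot : {dot V for Num.conj}.
Hypothesis hdot : norm_of_dot dot.
Local Notation ip := (rip dot).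
Local Notation sq := (nsq dot).
Variable E : proj_measure dot.
Local Notation mu x := (spec_mu E x).
Local Notation intble x f := ((mu x).-integrable setT (EFin \o f)).

Let pos : set (measurableTypeR R) := [set t | 0 < t].
Let neg : set (measurableTypeR R) := [set t | t < 0].

Let mpos : measurable pos.
Proof. by rewrite /pos -set_itvoy; exact: measurable_itv. Qed.

Let mneg : measurable neg.
Proof. by rewrite /neg -set_itvNyo; exact: measurable_itv. Qed.

(** The sign is itself a step function, so sign(B) = E(]0, +oo[) - E(]-oo, 0[). *)
Definition sg_step : @step R :=
  Step 2 (fun i => if i == 0 :> nat then 1 else -1)
         (fun i => if i == 0 :> nat then pos else neg)
         (fun i => match (i == 0 :> nat) as b return
            measurable (if b then pos else neg) with true => mpos | false => mneg end).

Lemma sg_step_op x : step_op dot E sg_step x = E pos x - E neg x.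
Proof.
rewrite /step_op !big_ord_recl big_ord0 /= addr0 scale1r.
by rewrite rmorphN1 scaleN1r.
Qed.

Lemma sg_step_val t : step_val sg_step t = Num.sg t.
Proof.
rewrite /step_val !big_ord_recl big_ord0 /= addr0 mul1r mulN1r !indicE.
have -> : (t \in pos) = (0 < t) by apply/idP/idP; rewrite inE.
have -> : (t \in neg) = (t < 0) by apply/idP/idP; rewrite inE.
have [t0|t0|->] := ltrgt0P t.
- by rewrite subr0 gtr0_sg.
- by rewrite sub0r ltr0_sg.
- by rewrite subrr sgr0.
Qed.

Lemma sign_opE x : app (sign_op E) x = E pos x - E neg x.
Proof.
have msg : measurable_fun setT (Num.sg : measurableTypeR R -> R).
  rewrite (_ : Num.sg = step_val sg_step); first exact: measurable_step_val.
  by apply/funext => t; rewrite sg_step_val.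
have sapp : step_approximates Num.sg (fun=> sg_step).
  split=> [n t|t]; first by rewrite sg_step_val.
  by under eq_fun do rewrite sg_step_val; exact: cvg_cst.
apply: app_eq; first exact: (fcalc_op dot hdot E _ _ msg sapp).
by apply/(fcalcP dot hdot E _ _ msg sapp); rewrite sg_step_op; exact: cvg_cst.
Qed.

Lemma rip_sign x y : ip x (app (sign_op E) y) = ip (app (sign_op E) x) y.
Proof. by rewrite !sign_opE -!sg_step_op step_op_sym. Qed.

Lemma sign_opD x y :
  app (sign_op E) (x + y) = app (sign_op E) x + app (sign_op E) y.
Proof. by rewrite !sign_opE -!sg_step_op step_opD. Qed.

Let sqrtabs (t : measurableTypeR R) : R := Num.sqrt `|t|.

Let m_sqrtabs : measurable_fun setT sqrtabs.
Proof.
apply: (@measurableT_comp _ _ _ _ _ _ (Num.sqrt : R -> R) _ (@Num.norm R R : R -> R)).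
  by apply: continuous_measurable_fun; exact: sqrt_continuous.
exact: normr_measurable.
Qed.

Let m_id : measurable_fun setT (idfun : measurableTypeR R -> R).
Proof. exact: measurable_id. Qed.

(** Both sides are the integral of t: on the left as |t| sg(t), with |t| the
    square of the function sqrt |t|. *)
Lemma rip_sqrt_sign x u v :
  sqrt_abs_op E (x, u) -> fcalc E (fun t => t) (x, v) ->
  ip u (app (sign_op E) u) = ip x v.
Proof.
move=> xu xv.
have [s hs] := ex_step_approximates _ m_sqrtabs.
have [s' hs'] := ex_step_approximates _ m_id.
rewrite (ripC dot x) (rip_fcalc dot hdot E _ _ m_id hs' _ _ xv).
rewrite sign_opE ripBr.
rewrite !(rip_fcalc_pvm dot hdot E _ _ m_sqrtabs hs _ _ _ _ xu) //.
have i2 := fcalc_dom_sq_integrable dot E sqrtabs m_sqrtabs x (proj1 xu).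
have i Y : measurable Y -> intble x (fun t => sqrtabs t ^+ 2 * \1_Y t).
  move=> mY; apply: (@dominated_integrable _ _ _ (fun t => sqrtabs t ^+ 2)) => //.
    by apply: measurable_funM; [exact: measurable_funX|apply: (measurable_indic mY)].
  move=> t; rewrite normrM (@ger0_norm _ (_ ^+ 2)) ?sqr_ge0 //.
  rewrite ler_piMr ?sqr_ge0 // indicE.
  by case: (_ \in _); rewrite ?normr1 ?normr0.
rewrite -RintegralB //; try exact: i.
apply: eq_Rintegral => t _; rewrite /sqrtabs sqr_sqrtr //.
rewrite -mulrBr; have := sg_step_val t.
rewrite /step_val !big_ord_recl big_ord0 /= addr0 mul1r mulN1r => ->.
by rewrite mulrC -numEsg.
Qed.

Variables (S B : set (V * V)) (H : {linear V -> V}).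
Hypothesis Ssa : selfadjoint dot S.
Hypothesis Hb : bounded_op H.
Hypothesis H_sym : forall x y, dot (H x) y = dot x (H y).
Hypothesis BE : is_spectral_measure_of E B.
Hypothesis rep : represents dot S H B.
Hypothesis domTS : dom (sqrt_abs_op E) = dom S.

Let Sop := selfadjoint_op dot S Ssa.
Local Notation T := (sqrt_abs_op E).
Local Notation G := (app (sign_op E)).

(** On the domain of B this is [rip_sqrt_sign].  The vectors E([-n, n]) x belong
    to it, and T commutes with E([-n, n]), so they converge to x in the graph
    norm of T, hence in that of S by [dom_inclusion_bound]. *)
Lemma quadratic_representation x w u : S (x, w) -> T (x, u) ->
  ip w (H w) = ip u (G u).
Proof.
move=> xw xu.
have [s hs] := ex_step_approximates _ m_sqrtabs.
have [s' hs'] := ex_step_approximates _ m_id.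
have Top : is_operator T := fcalc_op dot hdot E _ _ m_sqrtabs hs.
have [Bsa dBS hrep] := rep; have Bop := selfadjoint_op dot B Bsa.
have onB z v p q : B (z, v) -> S (z, p) -> T (z, q) -> ip p (H p) = ip q (G q).
  move=> zv zp zq.
  have := hrep z z (ex_intro _ p zp) (ex_intro _ v zv).
  rewrite /form_of (app_eq Sop zp) (app_eq Bop zv) {1}/rip => ->.
  by rewrite (rip_sqrt_sign z q v) //; move: zv; rewrite BE.
have [C C0 hC] : exists2 C : R, 0 <= C & forall y v w, T (y, v) -> S (y, w) ->
    sq w <= C * (sq y + sq v).
  apply: (dom_inclusion_bound dot hdot S T Ssa Top); last by rewrite domTS.
  move=> y v l c; exact: (fcalc_closed dot hdot E _ _ m_sqrtabs hs).
pose P n := E (sublevel (fun t : measurableTypeR R => t) n).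
have mP n : measurable (sublevel (fun t : measurableTypeR R => t) n).
  exact: (measurable_sublevel _ m_id).
have Pcvg y : P n y @[n --> \oo] --> y.
  exact: (pvm_sublevel_cvg dot hdot E _ m_id).
have TP n : T (P n x, P n u).
  by apply: (fcalc_pvm dot hdot E _ _ m_sqrtabs hs).
have /choice[v hv] n : exists v, B (P n x, v).
  rewrite BE; apply: (dom_fcalc dot hdot E _ _ m_id hs').
  exact: (fcalc_dom_sublevel dot hdot E _ _ m_id hs').
have /choice[p hp] n : exists p, S (P n x, p).
  have dT : dom T (P n x) by exists (P n u); exact: TP.
  by rewrite domTS in dT.
have pw : p n @[n --> \oo] --> w.
  apply/(cvg_nsq dot hdot).
  have /(cvg_nsq dot hdot) c1 := Pcvg x; have /(cvg_nsq dot hdot) c2 := Pcvg u.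
  apply: (@squeeze_cvgr _ _ _ _ (fun=> 0) (fun n => C * (sq (P n x - x) + sq (P n u - u)))).
  - near=> n; rewrite nsq_ge0 //=.
    exact: hC (operatorB Top (TP n) xu) (operatorB Sop (hp n) xw).
  - exact: cvg_cst.
  - have c12 := cvgD c1 c2; rewrite addr0 in c12.
    rewrite -(mulr0 C); apply: cvgMr; exact: c12.
have c1 := cvg_rip2 dot hdot _ _ _ _ pw (cvg_bounded_op dot hdot H _ _ Hb pw).
have c2 : G (P n u) @[n --> \oo] --> G u.
  rewrite sign_opE; under eq_fun do rewrite sign_opE.
  have PE Y : measurable Y -> E Y (P n u) @[n --> \oo] --> E Y u.
    move=> mY; apply: (cvg_bounded_op dot hdot); last exact: Pcvg.
    exact: (bounded_pvm dot hdot E Y mY).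
  by apply: cvgB; apply: PE.
have c3 := cvg_rip2 dot hdot _ _ _ _ (Pcvg u) c2.
apply: (cvg_unique (@Rhausdorff R) c1).
rewrite (_ : (fun n => _) = fun n => ip (P n u) (G (P n u))) //.
by apply/funext => n; exact: onB (hv n) (hp n) (TP n).
Unshelve. all: by end_near. Qed.

(** Polarization: the real parts of both sides are symmetric real bilinear forms
    with the same quadratic form; multiplying y by i gives the imaginary parts. *)
Lemma second_representation x y : dom S x -> dom S y ->
  form_of dot S H x y = dot (app T x) (G (app T y)).
Proof.
have [s hs] := ex_step_approximates _ m_sqrtabs.
have Top : is_operator T := fcalc_op dot hdot E _ _ m_sqrtabs hs.
move=> dx dy.
have [w xw] := dx; have [p yp] := dy.
have [u xu] : dom T x by rewrite domTS.
have [q yq] : dom T y by rewrite domTS.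
rewrite /form_of (app_eq Sop xw) (app_eq Sop yp) (app_eq Top xu) (app_eq Top yq).
have pol z k l : S (z, k) -> T (z, l) -> ip w (H k) = ip u (G l).
  move=> zk zl.
  have := quadratic_representation _ _ _ (operatorD Sop xw zk) (operatorD Top xu zl).
  have := quadratic_representation _ _ _ xw xu.
  have := quadratic_representation _ _ _ zk zl.
  have e1 : ip k (H w) = ip w (H k) by rewrite ripC /rip H_sym.
  have e2 : ip l (G u) = ip u (G l) by rewrite rip_sign ripC.
  rewrite (linearD H) sign_opD !(ripDl, ripDr) e1 e2.
  lra.
apply: dot_rip => k; set c := if k then _ else _.
have Gc : c *: G q = G (c *: q) by rewrite !sign_opE -!sg_step_op step_opZ.
rewrite Gc -linearZ_LR.
exact: pol (operatorZ c Sop yp) (operatorZ c Top yq).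
Qed.

End SecondRepresentation.

Theorem theorem1 (R : realType) (V : completeNormedModType R[i])
    (dot : {dot V for Num.conj}) (hdot : norm_of_dot dot)
    (A sqrtA : set (V * V)) (H Hinv J : {linear V -> V}) (alpha : R)
    (A_sa : selfadjoint dot A) (A_ge0 : nonneg_op dot A)
    (sqrtA_sqrt : is_sqrt dot A sqrtA)
    (H_sa : bounded_selfadjoint dot H)
    (Hinv_bounded : bounded_op Hinv)
    (HK : cancel H Hinv) (HinvK : cancel Hinv H)
    (J_inv : selfadjoint_involution dot J) (J_comm : commutes_with J A)
    (alpha_gt0 : 0 < alpha) (alpha_le1 : alpha <= 1)
    (H_pos : form_le dot (fun x => alpha%:C *: proj_pos J x)
                         (proj_pos J \o H \o proj_pos J))
    (H_neg : form_le dot (proj_neg J \o H \o proj_neg J)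
                         (fun x => - alpha%:C *: proj_neg J x)) :
  (exists! B : set (V * V), represents dot sqrtA H B) /\
  (forall B : set (V * V), represents dot sqrtA H B ->
     B = op_comp sqrtA (op_comp (graph H) sqrtA) /\
     (forall E : proj_measure dot, is_spectral_measure_of E B ->
        dom (sqrt_abs_op E) = dom sqrtA ->
        forall x y, dom sqrtA x -> dom sqrtA y ->
          form_of dot sqrtA H x y =
          dot (app (sqrt_abs_op E) x)
              (app (sign_op E) (app (sqrt_abs_op E) y)))).
Proof.
have [Ssa Snn SS] := sqrtA_sqrt.
have [Hb Hsym] := H_sa; have [[Jb Jsym] JJ] := J_inv.
have Sop := selfadjoint_op dot sqrtA Ssa; have Aop := selfadjoint_op dot A A_sa.
have pos x u : sqrtA (x, u) -> 0 <= rip dot u x.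
  move=> xu; have := Snn x (ex_intro _ u xu).
  by rewrite (app_eq Sop xu) lecE => /andP[].
have JA x u v : sqrtA (x, u) -> sqrtA (u, v) ->
    exists2 w, sqrtA (J x, w) & sqrtA (w, J v).
  move=> xu uv; have xv : A (x, v) by rewrite -SS; exists u.
  have [dJ e] := J_comm x (ex_intro _ v xv).
  have := app_graph dJ; rewrite -e (app_eq Aop xv) -SS => -[w [Jxw wv]].
  by exists w.
have JS : forall x u, sqrtA (x, u) -> sqrtA (J x, J u).
  apply: (commutes_sqrt dot hdot sqrtA Ssa J pos JJ _ JA).
  by move=> x y; rewrite /rip Jsym.
have coer := indefinite_coercive dot J H alpha Hsym Jsym H_pos H_neg.
have rep0 := sandwich_represents dot hdot J H alpha Hsym Jsym JJ sqrtA Ssa JS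
  coer alpha_gt0 alpha_le1 Hb Jb.
have uniq := represents_unique dot H Hsym sqrtA Ssa.
split.
  exists (op_comp sqrtA (op_comp (graph H) sqrtA)); split=> // B /uniq ->.
  by [].
move=> B repB; split; first exact: uniq.
move=> E BE domE x y dx dy.
exact: (second_representation dot hdot E sqrtA B H Ssa Hb Hsym BE repB domE).
Qed.
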